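(* Let $\mathcal N$ and $\mathcal M$ be nests on Banach spaces $X$ and $Y$, respectively, over the (real or complex) field $\mathbb F$, and let $\mathrm{Alg}\,\mathcal N$ and $\mathrm{Alg}\,\mathcal M$ be the associated nest algebras. Then a map $\Phi:\mathrm{Alg}\,\mathcal N\to\mathrm{Alg}\,\mathcal M$ is a Lie ring isomorphism (that is, $\Phi$ is additive, bijective and satisfies $\Phi([A,B])=[\Phi(A),\Phi(B)]$ for all $A,B\in\mathrm{Alg}\,\mathcal N$) if and only if $\Phi$ has the form $$\Phi(A)=\Psi(A)+h(A)I\quad\text{for all }A\in\mathrm{Alg}\,\mathcal N,$$ where $\Psi:\mathrm{Alg}\,\mathcal N\to\mathrm{Alg}\,\mathcal M$ is a ring isomorphism or the negative of a ring anti-isomorphism, and $h:\mathrm{Alg}\,\mathcal N\to\mathbb F$ is an additive functional satisfying $h([A,B])=0$ for all $A,B\in\mathrm{Alg}\,\mathcal N$.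
   Context: $\mathcal B(X)$ is the algebra of all bounded linear operators on $X$. A nest $\mathcal N$ on $X$ is a chain (totally ordered by inclusion) of norm-closed subspaces of $X$ containing $\{0\}$ and $X$ and closed under arbitrary closed linear spans and arbitrary intersections. The nest algebra is $\mathrm{Alg}\,\mathcal N=\{A\in\mathcal B(X): AN\subseteq N\ \text{for all }N\in\mathcal N\}$. $[A,B]=AB-BA$. Ring isomorphisms and ring anti-isomorphisms are additive bijections that are multiplicative, respectively anti-multiplicative; they are not assumed to be $\mathbb F$-linear.
   Formalization: In the ''if'' direction Φ is additionally assumed bijective: the stated form alone does not force this (for X = Y = F, Ψ = id and h(aI) = −a give Φ = 0). *)

(* Defs.v *)
From HB Require Import structures.
From mathcomp Require Import all_boot all_order all_algebra.
From mathcomp Require Import complex.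
From mathcomp Require Import boolp classical_sets functions reals topology.
From mathcomp Require Import normedtype.

Set Implicit Arguments.
Unset Strict Implicit.
Unset Printing Implicit Defensive.

Import Order.TTheory GRing.Theory Num.Theory.
Import numFieldNormedType.Exports.

Local Open Scope classical_set_scope.
Local Open Scope ring_scope.

Variant scalar_kind := RealScalars | ComplexScalars.

Definition scalar_field (R : realType) (k : scalar_kind) : numFieldType :=
  match k with RealScalars => R | ComplexScalars => R[i] end.

Section BoundedOperators.
Context {K : numFieldType} (X : normedModType K).

Definition bounded_operator : {pred X -> X} :=
  fun A => `[< linear A /\ exists c : K, forall x, `|A x| <= c * `|x| >].

Lemma bounded_operator_submod_closed : submod_closed bounded_operator.
Proof.
split=> [|a A B /asboolP[lA [c Ac]] /asboolP[lB [d Bd]]]; apply/asboolP; split.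
- by move=> a x y; rewrite /= scaler0 addr0.
- by exists 0 => x; rewrite /= normr0 mul0r.
- move=> b x y; rewrite !fctE lA lB !scalerDr !scalerA mulrC.
  by rewrite addrACA.
exists (`|a| * c + d) => x; rewrite !fctE mulrDl -mulrA.
apply: le_trans (ler_normD _ _) _; rewrite normrZ lerD//.
by rewrite ler_wpM2l.
Qed.

HB.instance Definition _ := GRing.isSubmodClosed.Build K (X -> X)
  bounded_operator bounded_operator_submod_closed.

(* The algebra B(X), the product being composition; as X may be {0}, the ring
   is possibly trivial, so B(X) is a pzRingType and an lmodType but not an
   instance of MathComp's (nontrivial) algType. *)
Record bounded_op := BoundedOp {
  op_fun :> X -> X;
  op_bounded : op_fun \in bounded_operator }.

HB.instance Definition _ := [isSub for op_fun].
HB.instance Definition _ := [Choice of bounded_op by <:].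
HB.instance Definition _ := [SubChoice_isSubZmodule of bounded_op by <:].
HB.instance Definition _ := [SubZmodule_isSubLmodule of bounded_op by <:].

Lemma bounded_opP (A B : bounded_op) : (forall x, A x = B x) -> A = B.
Proof. by move=> AB; apply/val_inj/funext. Qed.

Lemma bounded_op_linear (A : bounded_op) : linear A.
Proof. by have /asboolP[] := op_bounded A. Qed.

Lemma id_bounded : (@id X) \in bounded_operator.
Proof. by apply/asboolP; split=> //; exists 1 => x; rewrite mul1r. Qed.

Lemma comp_bounded (A B : bounded_op) : (A \o B) \in bounded_operator.
Proof.
have /asboolP[lA [c Ac]] := op_bounded A.
have /asboolP[lB [d Bd]] := op_bounded B.
apply/asboolP; split; first by move=> a x y /=; rewrite lB lA.
have [[x0 Bx0]|B0] := pselect (exists x, B x != 0).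
  exists (c * d) => x; apply: le_trans (Ac _) _; rewrite -mulrA ler_wpM2l//.
  by rewrite -(pmulr_lge0 c (_ : 0 < `|B x0|)) ?normr_gt0// (le_trans _ (Ac _)).
exists 0 => x /=; rewrite mul0r.
have -> : B x = 0 by apply/eqP/negPn/negP => Bx; apply: B0; exists x.
have -> : A 0 = 0 by have := lA (-1) 0 0; rewrite !scaleN1r !addNr.
by rewrite normr0.
Qed.

Definition op_one := BoundedOp id_bounded.
Definition op_mul (A B : bounded_op) := BoundedOp (comp_bounded A B).

Lemma op_mulA : associative op_mul.
Proof. by move=> A B C; apply: bounded_opP. Qed.

Lemma op_mul1 : left_id op_one op_mul.
Proof. by move=> A; apply: bounded_opP. Qed.

Lemma op_mulr1 : right_id op_one op_mul.
Proof. by move=> A; apply: bounded_opP. Qed.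

Lemma op_mulDl : left_distributive op_mul +%R.
Proof. by move=> A B C; apply: bounded_opP. Qed.

Lemma op_mulDr : right_distributive op_mul +%R.
Proof.
move=> A B C; apply: bounded_opP => x /=; rewrite !fctE /=.
by have := bounded_op_linear A 1 (B x) (C x); rewrite !scale1r.
Qed.

HB.instance Definition _ := GRing.Zmodule_isPzRing.Build bounded_op
  op_mulA op_mul1 op_mulr1 op_mulDl op_mulDr.

End BoundedOperators.

Section Nests.
Context {K : numFieldType} (X : normedModType K).

Definition is_subspace (V : set X) :=
  V 0 /\ forall (a : K) x y, V x -> V y -> V (a *: x + y).

Definition closed_span (S : set X) : set X := closure (smallest is_subspace S).

Definition is_nest (N : set (set X)) :=
  [/\ forall V, N V -> is_subspace V /\ closed V,
      forall U V, N U -> N V -> U `<=` V \/ V `<=` U,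
      N [set 0] /\ N setT,
      forall F, F `<=` N -> N (closed_span (\bigcup_(V in F) V))
    & forall F, F `<=` N -> N (\bigcap_(V in F) V)].

Record nest := Nest { nest_set :> set (set X); nestP : is_nest nest_set }.

Definition Alg (N : nest) : {pred bounded_op X} :=
  fun A => `[< forall V, nest_set N V -> A @` V `<=` V >].

Lemma Alg_submod_closed (N : nest) : submod_closed (Alg N).
Proof.
have sub V : nest_set N V -> is_subspace V.
  by have [+ _ _ _ _] := nestP N => /[apply] -[].
split=> [|a A B /asboolP NA /asboolP NB].
  apply/asboolP => V /sub[V0 _] _ [x Vx <-].
  exact: V0.
apply/asboolP => V NV _ [x Vx <-].
by apply: (sub V NV).2; [apply: (NA V NV)|apply: (NB V NV)]; exists x.
Qed.

Lemma Alg_mulr_closed (N : nest) : mulr_closed (Alg N).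
Proof.
split=> [|A B /asboolP NA /asboolP NB]; apply/asboolP => V NV _ [x Vx <-] //=.
by apply: (NA V NV); exists (B x) => //; apply: (NB V NV); exists x.
Qed.

HB.instance Definition _ (N : nest) := GRing.isSubmodClosed.Build K
  (bounded_op X) (Alg N) (Alg_submod_closed N).
HB.instance Definition _ (N : nest) := GRing.isMulClosed.Build
  (bounded_op X) (Alg N) (Alg_mulr_closed N).

Record nest_alg (N : nest) := NestAlg {
  nest_alg_op :> bounded_op X;
  nest_algP : nest_alg_op \in Alg N }.

HB.instance Definition _ (N : nest) := [isSub for @nest_alg_op N].
HB.instance Definition _ (N : nest) := [Choice of nest_alg N by <:].
HB.instance Definition _ (N : nest) :=
  [SubChoice_isSubZmodule of nest_alg N by <:].
HB.instance Definition _ (N : nest) :=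
  [SubZmodule_isSubLmodule of nest_alg N by <:].
HB.instance Definition _ (N : nest) := GRing.SubZmodule_isSubPzRing.Build
  (bounded_op X) (Alg N) (nest_alg N) (subringClosedP _).

End Nests.

Section Morphisms.
Context {A B : pzRingType}.

Definition lie_bracket (C : pzRingType) (x y : C) := x * y - y * x.

Definition ring_isomorphism (f : A -> B) :=
  [/\ {morph f : x y / x + y}, {morph f : x y / x * y} & bijective f].

Definition ring_antiisomorphism (f : A -> B) :=
  [/\ {morph f : x y / x + y}, {morph f : x y / x * y >-> y * x} & bijective f].

Definition lie_ring_isomorphism (f : A -> B) :=
  [/\ {morph f : x y / x + y},
      {morph f : x y / lie_bracket x y >-> lie_bracket x y} & bijective f].

End Morphisms.

(* Main.v *)
Require Import Defs.
From HB Require Import structures.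
From mathcomp Require Import all_boot all_order all_algebra.
From mathcomp Require Import complex.
From mathcomp Require Import boolp classical_sets reals topology normedtype.
From mathcomp Require Import ring lra.
From Stdlib Require Ncring Ncring_tac.

(** Write [x, y] = xy - yx and x o y = xy + yx, and let F be the scalar field.

    Given a Lie ring isomorphism Phi, carry the Jordan product of Alg N over to
    Alg M by B(x, y) = Phi(Phi^-1(x) o Phi^-1(y)).  This is a symmetric
    biadditive map for which every commutator map is a derivation:
    [B(x, y), z] = B([x, z], y) + B(x, [y, z]).  The heart of the proof is that
    on a nest algebra each map with these properties is standard,
    B(x, y) = c (x o y) + mu(x) y + mu(y) x + (a scalar)
    ([nest_standard]).  Once this is known, the rest is ring theory
    ([lie_isomorphism_standard]).  Both Jordan products have the associator
    (x o y) o z - x o (y o z) = [y, [x, z]], and comparing the two puts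
    (1 - c^2) [y, [x, z]] into F x + F z + F.  Hence c^2 = 1, unless the algebra
    is so small that x o y is itself a combination of x, y and 1, in which case
    c may be changed to 1.  Then S(x) = c x + mu(x) / 2 turns B into the Jordan
    product and multiplies brackets by c, so that S Phi is multiplicative for
    c = 1 and antimultiplicative for c = -1, and c S Phi differs from Phi by
    scalars.  No structure theory of isomorphisms is needed to tell the two
    cases apart, since the sign is the constant c.

    Standardness is read off from rank-one operators p (x) f : v |-> f(v) p.
    Such an operator lies in the nest algebra as soon as every member of the nest
    contains p or is killed by f, and functionals f are supplied by the
    Hahn-Banach theorem ([separating_scalar_field]).  Let L be the closed span of
    the members of the nest other than X.

    If L is not X, a functional that kills L gives an idempotent e = p (x) f with
    e A e = F e ([atom_minimal_corner]).  For m in (1 - e) A e and x in the corner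
    C = (1 - e) A (1 - e) one finds B(x, m) = T(x) m with T : C -> C additive and
    T [x, y] = [T x, y]; the only such T are x |-> c x + (a scalar)
    ([nest_centroid]).  After subtraction of c (x o y), the remaining Peirce
    components of B are forced ([standard_of_weights]).  The corner C acts on the
    kernel of f, and the members of the nest are comparable with that kernel, so
    the same alternative applies to C.  Its centroid is found from the center of
    the next corner, and centers are computed directly: there is no induction.

    If L is X, there may be no idempotents at all, but every proper member of the
    nest is properly contained in another one.  When many members lie between p
    and the kernel of f, p (x) f is a commutator [p (x) k, v (x) f] in many ways,
    and each of them restricts B(x, p (x) f); together they leave only
    c (x o (p (x) f)) + mu p (x) f ([product_rank_one]). *)

Set Implicit Arguments.
Unset Strict Implicit.
Unset Printing Implicit Defensive.
Import Order.TTheory GRing.Theory Num.Theory.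
Import numFieldNormedType.Exports.
Local Open Scope classical_set_scope.
Local Open Scope ring_scope.

(** * Extension of dominated functionals *)

(** The scalars of X are restricted along a morphism i from the reals: one
    statement then serves real and complex spaces. *)
Section DominatedExtension.
Context {R : realType} {K : numFieldType} (i : {rmorphism R -> K}).
Context {X : lmodType K} (p : X -> R).
Hypothesis pD : forall x y, p (x + y) <= p x + p y.
Hypothesis pZ : forall a x, 0 <= a -> p (i a *: x) = a * p x.

(** A partial functional is its graph, so that chains have unions. *)
Definition dominated_graph (G : set (X * R)) :=
  [/\ G (0, 0), forall x r y s, G (x, r) -> G (y, s) -> G (x + y, r + s),
      forall a x r, G (x, r) -> G (i a *: x, a * r)
    & forall x r, G (x, r) -> r <= p x].

(** If r and s were both values at x, every multiple of r - s would be at most p 0 = 0. *)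
Lemma dominated_graph_functional G x r s :
  dominated_graph G -> G (x, r) -> G (x, s) -> r = s.
Proof.
move=> [G0 GD GZ Gp] xr xs.
have p0 : p 0 = 0 by rewrite -(scale0r 0) -(rmorph0 i) pZ// mul0r.
have d t : t * (r - s) <= 0.
  rewrite -p0; apply: Gp.
  have := GZ t _ _ (GD _ _ _ _ xr (GZ (-1) _ _ xs)).
  by rewrite rmorphN1 scaleN1r subrr scaler0 mulN1r.
have := d (r - s); rewrite -expr2 => h.
by apply/eqP; rewrite -subr_eq0 -sqrf_eq0 eq_le h sqr_ge0.
Qed.

(** A value c at x0 is admissible when r - p (x - x0) <= c <= p (y + x0) - s for all
    (x, r) and (y, s) in the graph; subadditivity of p separates the two sides. *)
Lemma dominated_graph_extend G x0 : dominated_graph G ->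
  exists2 G', dominated_graph G' & G `<=` G' /\ exists r, G' (x0, r).
Proof.
move=> [G0 GD GZ Gp].
pose E := [set u.2 - p (u.1 - x0) | u in G].
have bnd x r y s : G (x, r) -> G (y, s) -> r - p (x - x0) <= p (y + x0) - s.
  move=> xr ys; have := Gp _ _ (GD _ _ _ _ xr ys).
  have := pD (x - x0) (y + x0).
  by rewrite addrACA addNr addr0 => h1 h2; lra.
have E0 : E !=set0 by exists (0 - p (0 - x0)); exists (0, 0).
have Eub y s : G (y, s) -> ubound E (p (y + x0) - s).
  by move=> ys _ [[x r] xr <-] /=; apply: bnd.
pose c := sup E.
have cle y s : G (y, s) -> c <= p (y + x0) - s.
  by move=> ys; apply: ge_sup => //; apply: Eub.
have lec x r : G (x, r) -> r - p (x - x0) <= c.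
  move=> xr; apply: ub_le_sup; last by exists (x, r).
  by exists (p (0 + x0) - 0); apply: Eub.
exists [set u | exists x r a, G (x, r) /\ u = (x + i a *: x0, r + a * c)].
  split.
  - by exists 0, 0, 0; rewrite rmorph0 scale0r mul0r !addr0.
  - move=> _ _ _ _ [x [r [a [xr [-> ->]]]]] [y [s [b [ys [-> ->]]]]].
    exists (x + y), (r + s), (a + b); split; first exact: GD.
    by rewrite rmorphD scalerDl mulrDl (addrACA x) (addrACA r).
  - move=> b _ _ [x [r [a [xr [-> ->]]]]].
    exists (i b *: x), (b * r), (b * a); split; first exact: GZ.
    by rewrite rmorphM scalerDr scalerA mulrDr mulrA.
  - move=> _ _ [x [r [a [xr [-> ->]]]]].
    have scal b : 0 < b -> forall y, p (x + i b *: y) = b * p (i b^-1 *: x + y).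
      move=> b0 y; rewrite -pZ ?ltW// scalerDr scalerA -rmorphM divff ?gt_eqF//.
      by rewrite rmorph1 scale1r.
    have [a0|a0|->] := ltgtP a 0.
    + have b0 : 0 < - a by rewrite oppr_gt0.
      have -> : i a *: x0 = i (- a) *: - x0 by rewrite rmorphN scaleNr scalerN opprK.
      rewrite scal//; have := lec _ _ (GZ (- a)^-1 _ _ xr).
      rewrite -(ler_pM2l b0) mulrBr mulrA divff ?gt_eqF// mul1r.
      by move=> h; lra.
    + rewrite scal//; have := cle _ _ (GZ a^-1 _ _ xr).
      rewrite -(ler_pM2l a0) mulrBr mulrA divff ?gt_eqF// mul1r.
      by move=> h; lra.
    + by rewrite rmorph0 scale0r mul0r !addr0; apply: Gp.
split; last first.
  by exists (0 + 1 * c), 0, 0, 1; split=> //; rewrite rmorph1 scale1r !add0r.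
move=> [x r] xr; exists x, r, 0; split=> //.
by rewrite rmorph0 scale0r mul0r !addr0.
Qed.

(** Hahn-Banach: a maximal graph is total. *)
Lemma dominated_extension G0 : dominated_graph G0 ->
  exists g : X -> R, [/\ {morph g : x y / x + y},
    forall a x, g (i a *: x) = a * g x, forall x, g x <= p x
    & forall x r, G0 (x, r) -> g x = r].
Proof.
move=> dG0.
(* the union with G0 keeps the empty chain dominated *)
pose P G := dominated_graph (G `|` G0).
have [|G [PG maxG]] := @Zorn_bigcup _ P.
  move=> F FP Ftot; rewrite /P; have [z0 D0 Z0 p0] := dG0.
  have join u v : (\bigcup_(G in F) G `|` G0) u -> (\bigcup_(G in F) G `|` G0) v ->
      exists G, [/\ dominated_graph G, G `<=` \bigcup_(G in F) G `|` G0, G u & G v].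
    have sub G : F G -> G `|` G0 `<=` \bigcup_(G in F) G `|` G0.
      by move=> FG w [Gw|?]; [left; exists G|right].
    move=> [[G FG Gu]|Gu] [[H FH Hv]|Hv].
    - have [GH|HG] := Ftot _ _ FG FH.
        by exists (H `|` G0); split; [exact: FP|exact: sub|left; exact: GH|left].
      by exists (G `|` G0); split; [exact: FP|exact: sub|left|left; exact: HG].
    - by exists (G `|` G0); split; [exact: FP|exact: sub|left|right].
    - by exists (H `|` G0); split; [exact: FP|exact: sub|right|left].
    - by exists G0; split => // w; right.
  split.
  - by right.
  - move=> x r y s /join/[apply] -[G [[_ GD _ _] Gs]] xr ys.
    by apply: Gs; apply: GD.
  - move=> a x r xr; have [G [[_ _ GZ _] Gs Gxr _]] := join _ _ xr xr.
    by apply: Gs; apply: GZ.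
  - move=> x r xr; have [G [[_ _ _ Gp] _ Gxr _]] := join _ _ xr xr.
    exact: Gp.
have tot x : {r | (G `|` G0) (x, r)}.
  apply/cid; have [G' dG' [sG' [r G'r]]] := dominated_graph_extend x PG.
  exists r; left; apply: contrapT => nG.
  apply: (maxG G').
    by split; [move=> u Gu; apply: sG'; left|move=> sub; apply: nG; apply: sub].
  rewrite /P setUidl// => u G0u; by apply: sG'; right.
have [_ MD MZ Mp] := PG.
have uniq x r : (G `|` G0) (x, r) -> sval (tot x) = r.
  by move=> xr; apply: dominated_graph_functional PG (svalP (tot x)) xr.
exists (fun x => sval (tot x)); split.
- by move=> x y; apply: uniq; apply: MD; apply: (svalP (tot _)).
- by move=> a x; apply: uniq; apply: MZ; apply: (svalP (tot _)).
- by move=> x; apply: Mp; apply: (svalP (tot _)).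
- by move=> x r xr; apply: uniq; right.
Qed.

End DominatedExtension.

(** * Separation of a point from a closed subspace *)

Definition bounded_functional {K : numFieldType} {X : normedModType K} (f : X -> K) :=
  scalar f /\ exists c : K, forall x, `|f x| <= c * `|x|.

Definition separating {K : numFieldType} (X : normedModType K) :=
  forall (V : set X) v, is_subspace V -> closed V -> ~ V v ->
  exists f : X -> K, [/\ bounded_functional f, forall x, V x -> f x = 0 & f v = 1].

Section RealSeparation.
Context {R : realType} {K : numFieldType} (i : {rmorphism R -> K}).
Context {X : normedModType K} (n : X -> R).
Hypothesis i_mono : forall a b, (i a <= i b) = (a <= b).
Hypothesis i_pos : forall e : K, 0 < e -> exists a, i a = e.
Hypothesis nE : forall x, `|x| = i (n x).

(** The functional w + t v |-> t on V + R v is dominated by the norm divided by the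
    distance from v to V. *)
Lemma real_separation (V : set X) v : is_subspace V -> closed V -> ~ V v ->
  exists (g : X -> R) (C : R), [/\ {morph g : x y / x + y},
    forall a x, g (i a *: x) = a * g x, forall x, `|g x| <= C * n x,
    forall x, V x -> g x = 0 & g v = 1].
Proof.
move=> [V0 VZ] clV nVv.
have [e e0 dist] : exists2 e : K, 0 < e & forall w, V w -> e <= `|v - w|.
  have /nbhs_ballP[e /= e0 sub] : nbhs v (~` V).
    by apply: open_nbhs_nbhs; split=> //; apply: closed_openC.
  exists e => // w Vu; rewrite (real_leNgt (gtr0_real e0) (normr_real _)).
  by apply/negP => lt; apply: (sub w) => //; rewrite -ball_normE.
have [C iC] := i_pos (e := e^-1) (eq_ind_r _ e0 (invr_gt0 e)).
have i_eq0 a : (i a == 0) = (a == 0) by rewrite fmorph_eq0.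
have norm_i a : `|i a| = i `|a|.
  have [a0|a0] := leP 0 a; first by rewrite !ger0_norm// -(rmorph0 i) i_mono.
  rewrite !ltr0_norm ?rmorphN// lt_neqAle -[X in _ <= X](rmorph0 i) i_mono ltW// andbT.
  by rewrite i_eq0 lt_eqF.
have n0 x : 0 <= n x by rewrite -i_mono rmorph0 -nE.
have C0 : 0 < C.
  rewrite lt_neqAle -i_mono rmorph0 iC invr_ge0 (ltW e0) andbT.
  by rewrite eq_sym -i_eq0 iC invr_eq0 gt_eqF.
pose p x := C * n x.
have pD x y : p (x + y) <= p x + p y.
  rewrite -mulrDr ler_pM2l// -i_mono rmorphD -!nE; exact: ler_normD.
have pZ a x : 0 <= a -> p (i a *: x) = a * p x.
  move=> a0; rewrite /p mulrCA; congr (C * _).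
  apply: (fmorph_inj i); rewrite rmorphM -!nE normrZ norm_i ger0_norm//.
pose G0 := [set u : X * R | V (u.1 - i u.2 *: v)].
have dG0 : dominated_graph i p G0.
  split.
  - by rewrite /G0 /= rmorph0 scale0r subr0.
  - move=> x r y s; rewrite /G0 /= rmorphD scalerDl opprD addrACA => Vx Vy.
    by have := VZ 1 _ _ Vx Vy; rewrite scale1r.
  - move=> a x r; rewrite /G0 /= rmorphM -scalerA -scalerBr => Vx.
    by have := VZ (i a) _ _ Vx V0; rewrite addr0.
  - move=> x r; rewrite /G0 /= => Vx.
    have [r0|r0] := leP r 0; first by apply: le_trans r0 _; rewrite mulr_ge0// ltW.
    have ir0 : i r != 0 by rewrite i_eq0 gt_eqF.
    have := VZ (- (i r)^-1) _ _ Vx V0; rewrite addr0 => /dist.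
    rewrite scaleNr opprK scalerBr scalerA mulVf// scale1r addrC subrK normrZ.
    rewrite normfV norm_i ger0_norm ?(ltW r0)// nE -(invrK e) -iC -!fmorphV -rmorphM i_mono.
    rewrite -(ler_pM2l C0) divff ?gt_eqF// mulrCA mulrC ler_pdivlMr ?mul1r//.
have [g [gD gZ gp gG]] := dominated_extension pD pZ dG0.
exists g, C; split=> //.
- move=> x; rewrite ler_norml gp andbT lerNl.
  have -> : - g x = g (- x) by rewrite -[in RHS]scaleN1r -(rmorphN1 i) gZ mulN1r.
  apply: le_trans (gp _) _; rewrite /p -[n (- x)](_ : n x = _)//.
  by apply: (fmorph_inj i); rewrite -!nE normrN.
- by move=> x Vx; apply: gG; rewrite /G0 /= rmorph0 scale0r subr0.
- by apply: gG; rewrite /G0 /= rmorph1 scale1r subrr.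
Qed.

End RealSeparation.

Lemma separating_real (R : realType) (X : normedModType R) : separating X.
Proof.
move=> V v subV clV nVv.
have [|||g [C [gD gZ gC gV gv]]] :=
  @real_separation R R idfun X (fun x => `|x|) _ _ _ V v subV clV nVv => //.
  by move=> e _; exists e.
exists g; split=> //; split; last by exists C.
by move=> a x y; rewrite gD gZ.
Qed.

(** A real functional g gives the complex functional x |-> g(x) - i g(i x), which at v
    has real part 1 and can be rescaled. *)
Lemma separating_complex (R : realType) (X : normedModType R[i]) : separating X.
Proof.
move=> V v subV clV nVv.
have [||x|g [C [gD gZ gC gV gv]]] := @real_separation R R[i] (real_complex R) X
    (fun x => complex.Re `|x|) _ _ _ V v subV clV nVv.
- exact: lecR.
- by move=> e e0; exists (complex.Re e); apply: RRe_real; apply: gtr0_real.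
- by apply/esym/RRe_real; apply: normr_real.
pose f x : R[i] := (g x)%:C%C - 'i%C * (g ('i%C *: x))%:C%C.
have fD : {morph f : x y / x + y}.
  by move=> x y; rewrite /f scalerDr !gD !rmorphD mulrDr opprD addrACA.
have fR a x : f (a%:C%C *: x) = a%:C%C * f x.
  rewrite /f scalerA [in g ('i%C * _ *: x)]mulrC -scalerA !gZ !rmorphM/=; ring.
have fi x : f ('i%C *: x) = 'i%C * f x.
  rewrite /f scalerA -expr2 sqr_i scaleN1r.
  have -> : g (- x) = - g x by rewrite -[in LHS]scaleN1r -(rmorphN1 (real_complex R)) gZ
    mulN1r.
  rewrite mulrBr mulrA -expr2 sqr_i rmorphN/=; ring.
have fZ a x : f (a *: x) = a * f x.
  by rewrite [a]complexE scalerDl fD fR -scalerA fi fR mulrA -mulrDl.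
have fC x : `|f x| <= (C + C)%:C%C * `|x|.
  have bd y : `|(g y)%:C%C| <= C%:C%C * `|y|.
    have -> : `|y| = (complex.Re `|y|)%:C%C by rewrite RRe_real ?normr_real.
    by rewrite normc_def/= expr0n/= addr0 sqrtr_sqr -rmorphM/= lecR.
  apply: le_trans (ler_normB _ _) _; rewrite rmorphD mulrDl lerD// normrM.
  have i1 : `|'i%C : R[i]| = 1 by rewrite normc_def/= expr0n/= expr1n add0r sqrtr1.
  by rewrite i1 mul1r; apply: le_trans (bd _) _; rewrite normrZ i1 mul1r.
have fv : f v != 0.
  apply/eqP => /(congr1 (@complex.Re R)); rewrite /f gv raddfB /= !mul0r mulr0 subr0 subr0.
  by move/eqP; rewrite oner_eq0.
have f0 x : V x -> f x = 0.
  move=> Vx; rewrite /f (gV _ Vx) gV; first by rewrite rmorph0 mulr0 subr0.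
  by have := subV.2 'i%C _ _ Vx subV.1; rewrite addr0.
exists (fun x => f x / f v); split.
- split; first by move=> a x y; rewrite fD fZ mulrDl mulrA.
  exists ((C + C)%:C%C * `|f v|^-1) => x.
  by rewrite normrM normfV mulrAC ler_wpM2r ?invr_ge0.
- by move=> x /f0->; rewrite mul0r.
- by rewrite divff.
Qed.

Lemma separating_scalar_field (R : realType) k (X : normedModType (scalar_field R k)) :
  separating X.
Proof. by case: k X => X; [exact: separating_real|exact: separating_complex]. Qed.

(** * Rings with central scalars: corners, centers and centroids *)

#[local] Instance pzRing_ops (A : pzRingType) :
  @Ncring.Ring_ops A 0 1 +%R *%R (fun x y => x - y) -%R (@eq A) := {}.

#[local] Instance pzRing_ring (A : pzRingType) :
  @Ncring.Ring A _ _ _ _ _ _ _ (pzRing_ops A).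
Proof.
constructor.
- exact: RelationClasses.eq_equivalence.
- by move=> x y -> z t ->.
- by move=> x y -> z t ->.
- by move=> x y -> z t ->.
- by move=> x y ->.
- exact: add0r.
- exact: addrC.
- exact: addrA.
- exact: mul1r.
- exact: mulr1.
- exact: mulrA.
- exact: mulrDl.
- by move=> x y z; apply: mulrDr.
- by [].
- exact: subrr.
Qed.

Ltac ncring := Ncring_tac.non_commutative_ring.

Local Notation "[! x , y ]" := (lie_bracket x y) (format "[! x ,  y ]").

Section CentralScalars.
Context {F : numFieldType} {A : pzRingType} (s : {rmorphism F -> A}).
Hypothesis sC : forall a x, s a * x = x * s a.

(** For an idempotent u this is the corner u A u.  Corners are kept as predicates on A
    because several of them, one inside the other, are compared. *)
Definition corner (u x : A) := u * x = x /\ x * u = x.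

Definition trivial_center u := forall c, corner u c ->
  (forall x, corner u x -> c * x = x * c) -> exists a, c = s a * u.

Definition trivial_centroid u := forall T : A -> A,
  (forall x, corner u x -> corner u (T x)) ->
  (forall x y, corner u x -> corner u y -> T (x + y) = T x + T y) ->
  (forall x y, corner u x -> corner u y -> T [!x, y] = [!T x, y]) ->
  exists (c : F) (mu : A -> F), forall x, corner u x ->
    T x = s c * x + s (mu x) * u.

(** e is an idempotent of u A u with one-dimensional corner, and the corner of u - e
    acts faithfully on (u - e) A e. *)
Record minimal_corner (u e : A) : Prop := MinimalCorner {
  mc_idem : u * u = u;
  mc_e : corner u e;
  mc_ee : e * e = e;
  mc_min : forall x, exists a, e * x * e = s a * e;
  mc_faithful : forall b, corner (u - e) b ->
    (forall m, e * m = 0 -> m * e = m -> u * m = m -> b * m = 0) -> b = 0 }.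

Lemma cornerD u x y : corner u x -> corner u y -> corner u (x + y).
Proof. by move=> [ux xu] [uy yu]; split; rewrite ?mulrDr ?mulrDl ?ux ?xu ?uy ?yu. Qed.

Lemma cornerN u x : corner u x -> corner u (- x).
Proof. by move=> [ux xu]; split; rewrite ?mulrN ?mulNr ?ux ?xu. Qed.

Lemma cornerB u x y : corner u x -> corner u y -> corner u (x - y).
Proof. by move=> ux uy; apply: cornerD => //; apply: cornerN. Qed.

Lemma cornerM u x y : corner u x -> corner u y -> corner u (x * y).
Proof. by move=> [ux xu] [uy yu]; split; rewrite ?mulrA ?ux// -mulrA yu. Qed.

Lemma corner_lie u x y : corner u x -> corner u y -> corner u [!x, y].
Proof. by move=> ux uy; apply: cornerB; apply: cornerM. Qed.

Lemma cornerZ u a x : corner u x -> corner u (s a * x).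
Proof. by move=> [ux xu]; split; rewrite -?mulrA ?xu// mulrA -sC -mulrA ux. Qed.

Lemma corner_conj u v x : v * v = v -> corner u v -> corner u (v * x * v).
Proof.
by move=> vv [uv vu]; split; rewrite ?mulrA ?uv// -!mulrA vu.
Qed.

Lemma corner_trans u v x : corner u v -> corner v x -> corner u x.
Proof.
move=> [uv vu] [vx xv]; split; first by rewrite -vx mulrA uv.
by rewrite -xv -mulrA vu.
Qed.

Lemma lieDl (x y z : A) : [!x + y, z] = [!x, z] + [!y, z].
Proof. by rewrite /lie_bracket; ncring. Qed.
Lemma lieBl (x y z : A) : [!x - y, z] = [!x, z] - [!y, z].
Proof. by rewrite /lie_bracket; ncring. Qed.
Lemma lieC (x y : A) : [!x, y] = - [!y, x].
Proof. by rewrite /lie_bracket; ncring. Qed.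
Lemma lieZl a (x y : A) : [!s a * x, y] = s a * [!x, y].
Proof. by rewrite /lie_bracket mulrBr !mulrA -(sC a y) -!mulrA. Qed.
Lemma lie_scalar a (x : A) : [!s a, x] = 0.
Proof. by rewrite /lie_bracket sC subrr. Qed.

Section Centroid.
Variables (u : A) (T : A -> A).
Hypothesis TD : forall x y, corner u x -> corner u y -> T (x + y) = T x + T y.
Hypothesis TL : forall x y, corner u x -> corner u y -> T [!x, y] = [!T x, y].

Lemma centroid0 : T 0 = 0.
Proof.
have u0 : corner u 0 by split; rewrite ?mulr0 ?mul0r.
by have := TD u0 u0; rewrite addr0 => /(congr1 (fun t => t - T 0)); rewrite addrK subrr.
Qed.

Lemma centroid_right x y : corner u x -> corner u y -> T [!x, y] = [!x, T y].
Proof.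
move=> ux uy; have uyx := corner_lie uy ux.
have := TD uyx (cornerN uyx); rewrite subrr centroid0 -lieC TL// => /esym/eqP.
by rewrite addrC addr_eq0 -lieC => /eqP.
Qed.

End Centroid.

Section MinimalCorner.
Variables (u e : A).
Hypothesis mc : minimal_corner u e.
Let v := u - e.

Lemma mc_ue : u * e = e. Proof. by have [] := mc_e mc. Qed.
Lemma mc_eu : e * u = e. Proof. by have [] := mc_e mc. Qed.
Lemma mc_ev : e * v = 0. Proof. by rewrite /v mulrBr mc_eu (mc_ee mc) ?subrr. Qed.
Lemma mc_ve : v * e = 0. Proof. by rewrite /v mulrBl mc_ue (mc_ee mc) ?subrr. Qed.
Lemma mc_vv : v * v = v.
Proof. by rewrite {2}/v mulrBr mc_ve subr0 /v mulrBl (mc_idem mc) mc_eu. Qed.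
Lemma mc_uv : corner u v.
Proof. by split; rewrite /v ?mulrBr ?mulrBl (mc_idem mc) ?mc_ue ?mc_eu. Qed.

Lemma corner_vP x : corner v x -> [/\ e * x = 0, x * e = 0 & corner u x].
Proof.
move=> vx; split; last exact: corner_trans mc_uv vx.
  by rewrite -vx.1 mulrA mc_ev mul0r.
by rewrite -vx.2 -mulrA mc_ve mulr0.
Qed.

Lemma corner_v_intro x : corner u x -> e * x = 0 -> x * e = 0 -> corner v x.
Proof. by move=> [ux xu] ex xe; split; rewrite /v ?mulrBl ?mulrBr ?ux ?xu ?ex ?xe subr0.
  Qed.

(** The off-diagonal Peirce components (u - e) A e and e A (u - e) of u A u *)
Definition lower m := [/\ e * m = 0, m * e = m & u * m = m].
Definition upper n := [/\ e * n = n, n * e = 0 & n * u = n].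

Lemma lower_corner m : lower m -> corner u m.
Proof. by move=> [em me um]; split=> //; rewrite -me -mulrA mc_eu. Qed.
Lemma upper_corner n : upper n -> corner u n.
Proof. by move=> [en ne nu]; split=> //; rewrite -en mulrA mc_ue. Qed.

Lemma lower_vxe x : corner u x -> lower (v * x * e).
Proof.
move=> [ux xu]; split; first by rewrite !mulrA mc_ev !mul0r.
  by rewrite -mulrA (mc_ee mc).
by rewrite !mulrA mc_uv.1.
Qed.
Lemma upper_exv x : corner u x -> upper (e * x * v).
Proof.
move=> [ux xu]; split; first by rewrite !mulrA (mc_ee mc).
  by rewrite -mulrA mc_ve mulr0.
by rewrite -mulrA mc_uv.2.
Qed.

Lemma peirce x : corner u x ->
  x = e * x * e + v * x * v + v * x * e + e * x * v.
Proof.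
move=> [ux xu].
have {1}-> : x = u * x * u by rewrite ux xu.
have -> : u = e + v by rewrite /v; ncring.
ncring.
Qed.

Lemma lower_mull x m : corner u x -> e * x = x * e -> lower m -> lower (x * m).
Proof.
move=> [ux xu] ex [em me um]; split; first by rewrite mulrA ex -mulrA em mulr0.
  by rewrite -mulrA me.
by rewrite mulrA ux.
Qed.

Lemma lowerN m : lower m -> lower (- m).
Proof. by move=> [em me um]; split; rewrite ?mulrN ?mulNr ?em ?me ?um ?oppr0. Qed.
Lemma lowerD m m' : lower m -> lower m' -> lower (m + m').
Proof.
by move=> [em me um] [em' me' um']; split; rewrite ?mulrDr ?mulrDl ?em ?me ?um ?em' ?me'
  ?um' ?addr0.
Qed.
Lemma lowerZ a m : lower m -> lower (s a * m).
Proof.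
move=> [em me um]; split; rewrite -?mulrA ?me//.
  by rewrite mulrA -sC -mulrA em mulr0.
by rewrite mulrA -sC -mulrA um.
Qed.

Lemma lower_mulr x m : corner u x -> e * x = x * e -> lower m ->
  exists a, m * x = s a * m.
Proof.
move=> ux ex [em me um]; have [a ea] := mc_min mc x.
exists a; have -> : m * x = m * (e * x * e).
  by rewrite -[e * x * e]mulrA -ex (mulrA e) (mc_ee mc) mulrA me.
by rewrite ea mulrA -sC -mulrA me.
Qed.

Lemma lower_lie x m : corner u x -> e * x = x * e -> lower m -> lower [!x, m].
Proof.
move=> ux ex lm; apply: lowerD; first exact: lower_mull.
by have [a ->] := lower_mulr ux ex lm; apply: lowerN; apply: lowerZ.
Qed.

Lemma diagonal_form x : corner u x -> e * x = x * e ->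
  exists a b, corner v b /\ x = s a * e + b.
Proof.
move=> ux ex; have [a ea] := mc_min mc x.
exists a, (x - s a * e).
have exe : s a * e = x * e by rewrite -ea ex -mulrA (mc_ee mc).
split; last by rewrite addrC subrK.
apply: corner_v_intro.
- by apply: cornerB => //; apply: cornerZ; apply: mc_e.
- by rewrite exe mulrBr -ex mulrA (mc_ee mc) ?subrr.
- by rewrite exe mulrBl -mulrA (mc_ee mc) ?subrr.
Qed.

Lemma lie_diagonal a b m : corner v b -> lower m ->
  [!s a * e + b, m] = b * m - s a * m.
Proof.
move=> vb [em me _]; have [eb _ _] := corner_vP vb.
have mb : m * b = 0 by rewrite -me -mulrA eb mulr0.
rewrite /lie_bracket mulrDl -mulrA em mulr0 add0r mulrDr mb addr0.
by rewrite mulrA -sC -mulrA me.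
Qed.

(** The lower component is a faithful module, so its elements decide whether a block
    diagonal element is scalar. *)
Lemma diagonal_scalar a b : corner v b ->
  (forall m, lower m -> b * m = s a * m) -> s a * e + b = s a * u.
Proof.
move=> vb bm; suff -> : b = s a * v by rewrite /v mulrBr addrC subrK.
apply/eqP; rewrite -subr_eq0; apply/eqP; apply: (mc_faithful mc).
  apply: cornerB => //; apply: cornerZ; split; exact: mc_vv.
move=> m em me um; rewrite mulrBl bm// -mulrA /v mulrBl um em subr0 subrr//.
Qed.

Lemma lie_lower m : lower m -> [!m, e] = m.
Proof. by move=> [em me um]; rewrite /lie_bracket em me subr0. Qed.
Lemma lie_upper n : upper n -> [!e, n] = n.
Proof. by move=> [em me um]; rewrite /lie_bracket em me subr0. Qed.

(** T commutes with the bracket by e and so respects the Peirce decomposition.  Its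
    value at e is t e + b with b central in the corner of v, hence b a scalar c v;
    as m = [m, e] for m in the lower component, T m = (t - c) m.  The map
    D = T - (t - c) kills the lower component, so D x is a scalar for x block
    diagonal by [diagonal_scalar], and D n = [D e, n] = 0 for n in the upper one. *)
Lemma minimal_corner_centroid : trivial_center v -> trivial_centroid u.
Proof.
move=> Zv T Tu TD TL.
have ue := mc_e mc.
have T0 := centroid0 TD; have TR := centroid_right TD TL.
have Tcomm x : corner u x -> e * x = x * e -> e * T x = T x * e.
  move=> ux ex; have := TL x e ux ue.
  rewrite {1}/lie_bracket ex subrr T0 => /esym/eqP; rewrite subr_eq0 => /eqP->//.
have [a [b [vb Te]]] := diagonal_form (Tu _ ue) (Tcomm _ ue erefl).
have [eb be ub] := corner_vP vb.
have [c bc] : exists c, b = s c * v.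
  apply: Zv => // x vx; have [ex xe ux] := corner_vP vx.
  have := TL e x ue ux; rewrite {1}/lie_bracket ex xe subrr T0 Te /lie_bracket.
  rewrite mulrDl -mulrA ex mulr0 add0r mulrDr mulrA -sC -mulrA xe mulr0 add0r.
  by move/esym/eqP; rewrite subr_eq0 => /eqP.
have Tlow m : lower m -> T m = s (a - c) * m.
  move=> lm; have um := lower_corner lm; have [em me um'] := lm.
  rewrite -{1}(lie_lower lm) TR// Te bc /lie_bracket mulrDr !mulrA -!sC -!mulrA me mulrDl.
  rewrite -!mulrA em /v mulrBr mulrBl um.1 um.2 em me subrr mulr0 rmorphB; ncring.
pose D x := T x - s (a - c) * x.
have DL x y : corner u x -> corner u y -> D [!x, y] = [!D x, y].
  move=> ux uy; rewrite /D TL// /lie_bracket mulrBl mulrBr !mulrBr !(mulrA y) -!sC; ncring.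
have Ddiag x : corner u x -> e * x = x * e -> exists t, D x = s t * u.
  move=> ux ex; have uDx : corner u (D x).
    by apply: cornerB; [apply: Tu|apply: cornerZ].
  have [|t [d [vd Dx]]] := diagonal_form uDx.
    by rewrite /D mulrBr mulrBl Tcomm// mulrA -sC -!mulrA ex.
  exists t; rewrite Dx; apply: diagonal_scalar => // m lm.
  have um := lower_corner lm; have [em me _] := lm.
  have := DL x m ux um; rewrite {1}/D Tlow ?subrr; last exact: lower_lie.
  rewrite Dx lie_diagonal// => /esym/eqP.
  by rewrite subr_eq0 => /eqP.
have De : exists t, D e = s t * u by apply: Ddiag.
have Dup n : upper n -> D n = 0.
  move=> un; have [t Det] := De; have [nu1 nu2] := upper_corner un.
  rewrite -(lie_upper un) DL; [|exact: ue|exact: upper_corner].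
  by rewrite Det /lie_bracket mulrA -sC -!mulrA nu1 nu2 subrr.
have Dlow m : lower m -> D m = 0 by move=> lm; rewrite /D Tlow// subrr.
have DD x y : corner u x -> corner u y -> D (x + y) = D x + D y.
  by move=> ux uy; rewrite /D TD//; ncring.
have Dscal x : exists t, corner u x -> D x = s t * u.
  have [ux|nux] := pselect (corner u x); last by exists 0.
  have ud : corner u (e * x * e + v * x * v).
    exact: cornerD (corner_conj _ (mc_ee mc) ue) (corner_conj _ mc_vv mc_uv).
  have [|t Dd] := Ddiag _ ud.
    by rewrite mulrDr (mulrDl (e * x * e)) !mulrA (mc_ee mc) mc_ev !mul0r -!mulrA (mc_ee
      mc) mc_ve !mulr0.
  exists t => _; have [lx ux'] := (lower_vxe ux, upper_exv ux).
  have [ul uu] := (lower_corner lx, upper_corner ux').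
  rewrite {1}(peirce ux) DD//; last exact: cornerD.
  by rewrite DD// Dd Dlow// Dup// !addr0.
have [mu muE] := choice Dscal.
exists (a - c), mu => x ux.
by rewrite -muE// addrC subrK.
Qed.

End MinimalCorner.

(** * Equivariant products and a minimal idempotent *)

Lemma mulrSn_eq0 (x : A) n : x *+ n.+1 = 0 -> x = 0.
Proof.
rewrite -mulr_natl -(rmorph_nat s) => /(congr1 ( *%R (s n.+1%:R^-1))).
by rewrite mulrA -rmorphM mulVf ?pnatr_eq0// rmorph1 mul1r mulr0.
Qed.

Lemma double_eq0 (x : A) : x + x = 0 -> x = 0.
Proof. by rewrite -mulr2n => /mulrSn_eq0. Qed.

Record equivariant_product (B : A -> A -> A) : Prop := EquivariantProduct {
  ep_sym : forall x y, B x y = B y x;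
  ep_add : forall x y z, B (x + y) z = B x z + B y z;
  ep_lie : forall x y z, [!B x y, z] = B [!x, z] y + B x [!y, z] }.

Definition standard_product (B : A -> A -> A) := exists (c : F) (mu : A -> F),
  forall x y, exists t,
    B x y = s c * (x * y + y * x) + s (mu x) * y + s (mu y) * x + s t.

Section EquivariantProduct.
Variable B : A -> A -> A.
Hypothesis eB : equivariant_product B.

Lemma ep_addr x y z : B x (y + z) = B x y + B x z.
Proof. by rewrite (ep_sym eB) (ep_add eB) !(ep_sym eB x). Qed.
Lemma ep_0 x : B 0 x = 0.
Proof. by have := ep_add eB 0 0 x; rewrite addr0 => /(congr1 (fun t => t - B 0 x));
  rewrite addrK subrr. Qed.
Lemma ep_opp x y : B (- x) y = - B x y.
Proof. by apply/eqP; rewrite -addr_eq0 -(ep_add eB) addNr ep_0. Qed.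
Lemma ep_oppr x y : B x (- y) = - B x y.
Proof. by rewrite (ep_sym eB) ep_opp (ep_sym eB). Qed.
Lemma ep_0r x : B x 0 = 0.
Proof. by rewrite (ep_sym eB) ep_0. Qed.

Lemma equivariant_sub_jordan c :
  equivariant_product (fun x y => B x y - s c * (x * y + y * x)).
Proof.
split=> [x y|x y z|x y z].
- by rewrite /= (ep_sym eB) (addrC (x * y)).
- by rewrite /= (ep_add eB); ncring.
- rewrite lieBl lieZl (ep_lie eB) /lie_bracket; ncring.
Qed.

Section MinimalIdempotent.
Variable e : A.
Hypothesis mc : minimal_corner 1 e.
Let v := 1 - e.
Let low := lower 1 e.
Let upp := upper 1 e.
Let c1 x : corner 1 x. Proof. by split; rewrite ?mul1r ?mulr1. Qed.
Let ee : e * e = e. Proof. exact: mc_ee mc. Qed.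

Let upp_of_lie t : [!e, t] = t -> upp t.
Proof.
move=> te; have et : t * e = 0.
  have h : t * e + t * e = e * t * e.
    by rewrite -{1}te /lie_bracket mulrBl -!mulrA ee subrK.
  have : e * t * e + e * t * e = e * t * e by rewrite -!mulrA -mulrDr h !mulrA ee.
  by move=> h0; apply: double_eq0; rewrite h; apply: (addrI (e * t * e)); rewrite addr0.
by split; rewrite ?mulr1// -{2}te /lie_bracket et subr0.
Qed.

Let lie_e_double t : [!t, e] = t + t -> t = 0.
Proof.
move=> h; have h1 : e * t * e = 0.
  apply: double_eq0; have := congr1 (fun x => e * x * e) h.
  by rewrite /lie_bracket mulrBr mulrBl !mulrA ee -!mulrA ee subrr mulrDl mulrDr !mulrA
    => <-.
have h2 : e * t = 0.
  apply: (@mulrSn_eq0 _ 2); have := congr1 (fun x => e * x) h.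
  rewrite /lie_bracket mulrBr !mulrA ee h1 sub0r mulrDr => /eqP.
  by rewrite eq_sym -subr_eq0 opprK -mulr2n -mulrSr => /eqP.
have h3 : t * e = 0.
  apply: double_eq0; have := congr1 (fun x => x * e) h.
  rewrite /lie_bracket h2 subr0 -mulrA ee mulrDl => /esym/eqP.
  by rewrite -subr_eq0 addrK => /eqP->; rewrite addr0.
by apply: double_eq0; rewrite -h /lie_bracket h2 h3 subr0.
Qed.

Let lie_e_double' t : [!e, t] = t + t -> t = 0.
Proof.
move=> h; have h1 : e * t * e = 0.
  apply: double_eq0; have := congr1 (fun x => e * x * e) h.
  by rewrite /lie_bracket mulrBr mulrBl !mulrA ee -!mulrA ee subrr mulrDl mulrDr !mulrA
    => <-.
have h2 : t * e = 0.
  apply: (@mulrSn_eq0 _ 2); have := congr1 (fun x => x * e) h.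
  rewrite /lie_bracket mulrBl h1 -mulrA ee sub0r mulrDl => /eqP.
  by rewrite eq_sym -subr_eq0 opprK -mulr2n -mulrSr => /eqP.
have h3 : e * t = 0.
  apply: double_eq0; have := congr1 (fun x => e * x) h.
  rewrite /lie_bracket h2 subr0 mulrA ee mulrDr => /esym/eqP.
  by rewrite -subr_eq0 addrK => /eqP->; rewrite addr0.
by apply: double_eq0; rewrite -h /lie_bracket h2 h3 subr0.
Qed.

Let diag x := e * x = x * e.

Let lie_diag x : diag x <-> [!x, e] = 0.
Proof.
rewrite /lie_bracket; split=> [->|/eqP]; first by rewrite subrr.
by rewrite subr_eq0 => /eqP.
Qed.

Let diag_e : diag e. Proof. by []. Qed.

Let diag_scalar t : diag t -> (forall m, low m -> [!t, m] = 0) -> exists a, t = s a.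
Proof.
move=> dt tm; have [a [b [vb tE]]] := diagonal_form mc (c1 t) dt.
exists a; rewrite tE (diagonal_scalar mc vb) ?mulr1// => m lm.
by apply/eqP; rewrite -subr_eq0 -(lie_diagonal mc)// -tE tm.
Qed.

Let lie_low_e m : low m -> [!m, e] = m. Proof. exact: lie_lower. Qed.
Let lie_e_low m : low m -> [!e, m] = - m.
Proof. by move=> lm; rewrite lieC lie_low_e. Qed.
Let lie_upp_e n : upp n -> [!n, e] = - n.
Proof. by move=> un; rewrite lieC (lie_upper un). Qed.

Let low_lie x m : diag x -> low m -> low [!x, m].
Proof. by move=> dx lm; apply: (lower_lie mc). Qed.

Let upp_lie x n : diag x -> upp n -> upp [!n, x].
Proof.
move=> dx [en ne _]; apply: upp_of_lie.
have h1 : e * (n * x) = n * x by rewrite mulrA en.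
have h2 : e * (x * n) = x * n by rewrite mulrA dx -mulrA en.
have h3 : n * x * e = 0 by rewrite -mulrA -dx mulrA ne mul0r.
have h4 : x * n * e = 0 by rewrite -mulrA ne mulr0.
by rewrite /lie_bracket mulrBr mulrBl h1 h2 h3 h4 !subr0.
Qed.

Section Weights.
Hypothesis weight : forall x, diag x -> exists w, forall m, low m -> B x m = s w * m.

(** Once block diagonal elements act on the lower component through scalars (weights),
    equivariance determines B: bracketing with the lower component detects block
    diagonal values, and bracketing with e detects the degree of the others. *)
Let has_weight x w := forall m, low m -> B x m = s w * m.

Lemma product_diag_diag x y wx wy : diag x -> diag y ->
  has_weight x wx -> has_weight y wy -> exists t, B x y = s wx * y + s wy * x + s t.
Proof.
move=> dx dy hx hy.
have [||t tE] := @diag_scalar (B x y - s wx * y - s wy * x).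
- apply/lie_diag; rewrite !lieBl !lieZl ep_lie// (lie_diag x).1// (lie_diag y).1//.
  by rewrite ep_0 ep_0r !mulr0 addr0 !subr0.
- move=> m lm; rewrite !lieBl !lieZl (ep_lie eB) hx ?(ep_sym eB _ y) ?hy;
  try exact: low_lie.
  ncring.
- by exists t; rewrite -tE; ncring.
Qed.

Lemma product_diag_upper x w n : diag x -> has_weight x w -> upp n -> B x n = s w * n.
Proof.
move=> dx hx un; have [we he] := weight diag_e.
have un' := upp_lie dx un.
have Be n' : upp n' -> B e n' = s we * n'.
  move=> u'; have [t tE] := product_diag_diag diag_e diag_e he he.
  apply/eqP; rewrite -subr_eq0; apply/eqP/double_eq0.
  have := ep_lie eB e e n'; rewrite tE !lieDl !lieZl lie_scalar (lie_upper u').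
  rewrite (ep_sym eB n') => h; transitivity (B e n' + B e n' - (s we * n' + s we * n' + 0)).
    ncring.
  by rewrite h subrr.
have [t tE] := product_diag_diag dx diag_e hx he.
have := ep_lie eB x e n; rewrite tE !lieDl !lieZl lie_scalar (lie_upper un) addr0.
rewrite (lieC x n) ep_opp (ep_sym eB _ e) Be// mulrN => h.
by apply: (addrI (- (s we * [!n, x]))); rewrite -h addrC.
Qed.

(** B m n is a multiple w e up to scalars; evaluating [B m n, m] in two ways gives
    - w m = w m. *)
Lemma product_lower_upper m n : low m -> upp n -> exists t, B m n = s t.
Proof.
move=> lm un.
have [->|/eqP m0] := eqVneq m 0; first by exists 0; rewrite ep_0 rmorph0.
have [we he] := weight diag_e.
have dnm k : low k -> diag [!n, k].
  move=> lk; apply/lie_diag; have [ek ke _] := lk; have [en ne _] := un.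
  have h1 : n * k * e = n * k by rewrite -mulrA ke.
  have h2 : k * n * e = 0 by rewrite -mulrA ne mulr0.
  have h3 : e * (n * k) = n * k by rewrite mulrA en.
  have h4 : e * (k * n) = 0 by rewrite mulrA ek mul0r.
  by rewrite /lie_bracket mulrBl mulrBr h1 h2 h3 h4 subrr.
have Bmn k : low k -> forall w, has_weight [!n, k] w -> exists t, B k n = s w * e + s t.
  move=> lk w hw; have [t tE] := product_diag_diag diag_e (dnm k lk) he hw.
  have := ep_lie eB e n k; rewrite (product_diag_upper diag_e he un) lieZl tE lie_e_low//.
  rewrite ep_opp => h; exists t; apply: (addrI (- B k n)).
  by rewrite addNr; apply: (addrI (s we * [!n, k])); rewrite addr0 {1}h; ncring.
have [w hw] := weight (dnm m lm).
have [t tE] := Bmn m lm w hw.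
exists t; rewrite tE; suff -> : s w * e = 0 by rewrite add0r.
have mm : m * m = 0 by case: lm => em me _; rewrite -{1}me -mulrA em mulr0.
have := ep_lie eB m n m; rewrite tE lieDl lieZl lie_scalar addr0 lie_e_low//.
rewrite {1}/lie_bracket mm subrr ep_0 add0r (ep_sym eB) hw// => h.
have wm : s w * m = 0.
  by apply: double_eq0; rewrite -{1}h mulrN addNr.
have [->|w0] := eqVneq w 0; first by rewrite rmorph0 mul0r.
by case: m0; rewrite -(mul1r m) -(rmorph1 s) -(mulVf w0) rmorphM -mulrA wm mulr0.
Qed.

(** A value of degree 2 or -2 under the bracket by e vanishes, the degrees of the
    Peirce components being 0, 1 and -1. *)
Lemma product_lower_lower m m' : low m -> low m' -> B m m' = 0.
Proof. by move=> lm lm'; apply: lie_e_double; rewrite (ep_lie eB) !lie_low_e. Qed.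

Lemma product_upper_upper m m' : upp m -> upp m' -> B m m' = 0.
Proof.
move=> lm lm'; apply: lie_e_double'; rewrite lieC (ep_lie eB) !lie_upp_e//.
by rewrite ep_opp ep_oppr opprD !opprK.
Qed.

Lemma standard_of_weights : exists mu : A -> F, forall x y, exists t,
    B x y = s (mu x) * y + s (mu y) * x + s t.
Proof.
have dec z : exists w, exists d l u,
    [/\ diag d, has_weight d w, low l, upp u & z = d + l + u].
  have dd : diag (e * z * e + v * z * v).
    rewrite /diag mulrDr (mulrDl (e * z * e)) !mulrA ee (mc_ev mc) !mul0r.
    by rewrite -!mulrA ee (mc_ve mc) !mulr0.
  have [w hw] := weight dd; exists w, (e * z * e + v * z * v), (v * z * e), (e * z * v).
  by split=> //; [exact: lower_vxe|exact: upper_exv|exact: peirce (c1 z)].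
have [mu muE] := choice dec; exists mu => x y.
have [dx [lx [ux [ddx hx llx uux xE]]]] := muE x.
have [dy [ly [uy [ddy hy lly uuy yE]]]] := muE y.
have [t1 E1] := product_diag_diag ddx ddy hx hy.
have [t2 E2] := product_lower_upper llx uuy.
have [t3 E3] := product_lower_upper lly uux.
exists (t1 + t2 + t3); rewrite {1}xE {1}yE !(ep_add eB) !ep_addr E1 E2 (ep_sym eB ux ly) E3.
rewrite hx// (product_diag_upper ddx hx)// !(ep_sym eB _ dy) hy//.
rewrite (product_diag_upper ddy hy)// product_lower_lower// product_upper_upper//.
by move: (mu x) (mu y) => a b; rewrite xE yE !rmorphD; ncring.
Qed.

End Weights.

End MinimalIdempotent.
End EquivariantProduct.

Lemma scalar_eq0 a (x : A) : s a * x = 0 -> a = 0 \/ x = 0.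
Proof.
have [->|a0] := eqVneq a 0; first by left.
move=> /(congr1 ( *%R (s a^-1))); rewrite mulrA -rmorphM mulVf// rmorph1 mul1r mulr0.
by right.
Qed.

Lemma jordan_equivariant : equivariant_product (fun x y : A => x * y + y * x).
Proof.
split=> [x y|x y z|x y z]; first by rewrite addrC.
  by rewrite /=; ncring.
by rewrite /lie_bracket; ncring.
Qed.

(** Comparing y m, y m0 and y (m + m0) shows that the scalars at different points
    agree. *)
Lemma lower_pointwise_scalar e y : minimal_corner 1 e -> corner (1 - e) y ->
  (forall m, lower 1 e m -> exists a, y * m = s a * m) -> exists a, y = s a * (1 - e).
Proof.
move=> mc vy ym.
have [[m0 [l0 n0]]|no] := pselect (exists m, lower 1 e m /\ m <> 0); last first.
  exists 0; rewrite rmorph0 mul0r; apply: (mc_faithful mc) => // m em me um.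
  suff -> : m = 0 by rewrite mulr0.
  by apply: contrapT => m0; apply: no; exists m.
have [a ya] := ym _ l0.
exists a; have av : corner (1 - e) (s a * (1 - e)).
  by apply: cornerZ; split; exact: mc_vv mc.
apply/eqP; rewrite -subr_eq0; apply/eqP; apply: (mc_faithful mc); first exact: cornerB.
move=> m em me um; have lm : lower 1 e m by [].
rewrite mulrBl -mulrA mulrBl mul1r em subr0; apply/eqP; rewrite subr_eq0; apply/eqP.
have [b yb] := ym _ lm.
have [c yc] := ym _ (lowerD lm l0).
have h : s (b - c) * m = s (c - a) * m0.
  apply: (addrI (s c * m - s a * m0)); rewrite !rmorphB !mulrBl.
  transitivity (y * m - s a * m0); first by rewrite yb; ncring.
  transitivity (y * (m + m0) - s a * m0 - s a * m0); last by rewrite yc; ncring.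
  by rewrite mulrDr ya; ncring.
have [bc|bc] := eqVneq b c.
  move: h; rewrite bc subrr rmorph0 mul0r => /esym/scalar_eq0[|//] /eqP.
  by rewrite subr_eq0 => /eqP ca; rewrite yb bc ca.
have -> : m = s ((b - c)^-1 * (c - a)) * m0.
  by rewrite rmorphM -mulrA -h mulrA -rmorphM mulVf ?subr_eq0// rmorph1 mul1r.
by rewrite mulrA -sC -mulrA ya mulrA -rmorphM mulrC rmorphM -mulrA.
Qed.

(** On the corner C of v, B x m = T x m for an element T x of C, because B x e is block
    diagonal and [B x e, m] = B (x m) e - B x m.  T is in the centroid of C, so
    T x = c x + (a scalar), and B minus c times the Jordan product has weights. *)
Lemma minimal_idempotent_standard e : minimal_corner 1 e ->
  trivial_center (1 - e) -> trivial_centroid (1 - e) ->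
  forall B, equivariant_product B -> standard_product B.
Proof.
move=> mc Zv Cv B eB; set v := 1 - e.
have ee := mc_ee mc; have cu x : corner 1 x by split; rewrite ?mul1r ?mulr1.
have lie0 x y : e * x = x * e -> e * y = y * e -> e * B x y = B x y * e.
  move=> ex ey; have := ep_lie eB x y e; rewrite /lie_bracket ex ey !subrr.
  by rewrite (ep_0 eB) (ep_0r eB) addr0 => /eqP; rewrite subr_eq0 => /eqP.
have Bdiag x y : e * x = x * e -> e * y = y * e ->
    exists a b, corner v b /\ B x y = s a * e + b.
  by move=> ex ey; apply: (diagonal_form mc (cu _)); apply: lie0.
have dv b : corner v b -> e * b = b * e.
  by move=> vb; have [-> -> _] := corner_vP mc vb.
have de a : e * (s a * e) = s a * e * e by rewrite mulrA -sC -!mulrA ee.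
have lie_em m : lower 1 e m -> [!e, m] = - m by move=> lm; rewrite lieC (lie_lower lm).
(* its component in the corner of v is central there *)
have Bee a : exists c d, B (s a * e) e = s c * e + s d * v.
  have [c [d [vd E]]] := Bdiag _ _ (de a) erefl.
  have [d' dE] : exists d', d = s d' * v.
    apply: Zv => // x vx; have [ex xe _] := corner_vP mc vx.
    have := ep_lie eB (s a * e) e x.
    rewrite lieZl {2 3}/lie_bracket ex xe subrr mulr0 (ep_0 eB) (ep_0r eB) addr0 E.
    rewrite /lie_bracket mulrDl mulrDr -!mulrA ex mulr0 add0r mulrA -sC -mulrA xe mulr0
      add0r.
    by move/eqP; rewrite subr_eq0 => /eqP.
  by exists c, d'; rewrite E dE.
have vm m : lower 1 e m -> v * m = m.
  by move=> [em _ _]; rewrite /v mulrBl mul1r em subr0.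
have cv a : corner v (s a * v) by apply: cornerZ; split; exact: mc_vv mc.
have [c1 Bem] : exists c1, forall m, lower 1 e m -> B e m = s c1 * m.
  have [c [d E]] := Bee 1; rewrite rmorph1 mul1r in E.
  exists (- 2^-1 * (d - c)) => m lm; have := ep_lie eB e e m.
  rewrite E (lie_diagonal mc)// lie_em// (ep_oppr eB) (ep_opp eB) -mulrA vm// (ep_sym eB
    m) -mulrBl -rmorphB => h.
  rewrite rmorphM -mulrA h -opprD rmorphN mulrNN mulrDr -mulrDl -rmorphD.
  by rewrite (_ : 2^-1 + 2^-1 = 1) ?rmorph1 ?mul1r//; field.
have Baem a : exists w, forall m, lower 1 e m -> B (s a * e) m = s w * m.
  have [c [d E]] := Bee a; exists (c - d - c1 * a) => m lm; have := ep_lie eB (s a * e) e m.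
  rewrite E (lie_diagonal mc)// lieZl lie_em// mulrN (ep_oppr eB) (ep_opp eB) -mulrA vm//.
  rewrite (ep_sym eB _ e) Bem; last exact: lowerZ.
  move=> h; have -> : B (s a * e) m = - (s c1 * (s a * m)) - (s d * m - s c * m).
    by rewrite h; ncring.
  by rewrite !rmorphB rmorphM; ncring.
have low_x x m : corner v x -> lower 1 e m -> lower 1 e (x * m) /\ [!x, m] = x * m.
  move=> vx lm; have [ex xe _] := corner_vP mc vx; split.
    exact: lower_mull (cu x) (dv _ vx) lm.
  by case: lm => _ me _; rewrite /lie_bracket -{2}me -mulrA ex mulr0 subr0.
have diag_val x : exists ay : F * A, corner v x -> corner v ay.2 /\ B x e = s ay.1 * e +
  ay.2.
  have [vx|] := pselect (corner v x); last by exists (0, 0).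
  by have [a [y [vy E]]] := Bdiag _ _ (dv _ vx) erefl; exists (a, y).
have [ay ayE] := choice diag_val.
pose T x := s c1 * x - (ay x).2 + s (ay x).1 * v.
have vT x : corner v x -> corner v (T x).
  by move=> vx; apply: cornerD => //; apply: cornerB; [exact: cornerZ|exact: (ayE x vx).1].
have BT x m : corner v x -> lower 1 e m -> B x m = T x * m.
  move=> vx lm; have [vy E] := ayE x vx; have [lxm xm] := low_x x m vx lm.
  have := ep_lie eB x e m; rewrite E (lie_diagonal mc)// xm lie_em// (ep_oppr eB) (ep_sym
    eB _ e) Bem// => h.
  rewrite /T !mulrDl -(mulrA _ v) vm//.
  transitivity (s c1 * (x * m) - (s c1 * (x * m) - B x m)); first by ncring.
  by rewrite -h; ncring.
have vfaith x y : corner v x -> corner v y -> (forall m, lower 1 e m -> x * m = y * m) ->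
  x = y.
  move=> vx vy xy; apply/eqP; rewrite -subr_eq0; apply/eqP.
  apply: (mc_faithful mc); first exact: cornerB.
  by move=> m em me um; rewrite mulrBl xy ?subrr.
have [c [tau TE]] : exists (c : F) (mu : A -> F), forall x, corner v x ->
    T x = s c * x + s (mu x) * v.
  apply: Cv => // [x y vx vy|x y vx vy].
    have vxy := cornerD vx vy; apply: vfaith => [|| m lm]; [exact: vT|by apply: cornerD;
      apply: vT|].
    by rewrite -BT// (ep_add eB) (BT x)// (BT y)// -mulrDl.
  have vxy := corner_lie vx vy; apply: vfaith => [|| m lm]; first exact: vT.
    exact: corner_lie (vT x vx) vy.
  have [lym ym] := low_x y m vy lm.
  have := ep_lie eB x m y; rewrite (lieC m y) ym (ep_oppr eB) !BT//.
  have [[_ me _] [ey _ _]] := (lm, corner_vP mc vy).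
  have my : m * y = 0 by rewrite -me -mulrA ey mulr0.
  rewrite {1}/lie_bracket -mulrA my mulr0 sub0r => h.
  apply: (addIr (- (T x * (y * m)))); rewrite -h /lie_bracket; ncring.
have [|mu muE] := standard_of_weights (equivariant_sub_jordan eB c) mc.
  move=> x dx; have [a [b [vb xE]]] := diagonal_form mc (cu x) dx.
  have [w hw] := Baem a; exists (w + tau b - c * a) => m lm.
  have [em me _] := lm; have [eb _ _] := corner_vP mc vb.
  have mb : m * b = 0 by rewrite -me -mulrA eb mulr0.
  have -> : x * m = b * m by rewrite xE mulrDl -mulrA em mulr0 add0r.
  have -> : m * x = s a * m by rewrite xE mulrDr mb addr0 mulrA -sC -mulrA me.
  rewrite xE (ep_add eB) hw// BT// TE// !mulrDl -(mulrA _ v) vm// rmorphB rmorphD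
    rmorphM; ncring.
exists c, mu => x y; have [t E] := muE x y; exists t.
by rewrite -(subrK (s c * (x * y + y * x)) (B x y)) E; ncring.
Qed.

(** For y in the corner of v and m in the lower component, [y, [m, e]] = y m.  If this is
    always a combination of m, e and 1, then y acts by scalars, the corner of v is
    one-dimensional, and the Jordan product has weights.  The second alternative covers
    the two-by-two matrices, where x o y = tr(x) y + tr(y) x + (a scalar). *)
Lemma minimal_idempotent_large_or_standard e : minimal_corner 1 e ->
  (exists x y z, forall a b c, [!y, [!x, z]] <> s a * x + s b * z + s c) \/
  exists sg : A -> F, forall x y, exists t,
    x * y + y * x = s (sg x) * y + s (sg y) * x + s t.
Proof.
move=> mc; have ee := mc_ee mc.
have cu x : corner 1 x by split; rewrite ?mul1r ?mulr1.
have [scal|] := pselect (forall y, corner (1 - e) y -> exists a, y = s a * (1 - e)).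
  right; apply: (standard_of_weights jordan_equivariant mc) => x dx.
  have [a [b [vb xE]]] := diagonal_form mc (cu x) dx.
  have [c bE] := scal b vb; exists (c + a) => m [em me _].
  have [eb _ _] := corner_vP mc vb.
  have mb : m * b = 0 by rewrite -me -mulrA eb mulr0.
  rewrite xE mulrDl mulrDr mb addr0 (mulrA m) -sC -!mulrA em me mulr0 add0r bE -mulrA.
  by rewrite mulrBl mul1r em subr0 rmorphD mulrDl.
move=> nscal; left; apply: contrapT => P; apply: nscal => y vy.
apply: (lower_pointwise_scalar mc vy) => m lm.
have [a [b [c E]]] : exists a b c, [!y, [!m, e]] = s a * m + s b * e + s c.
  apply: contrapT => nE; apply: P; exists m, y, e => a b c E.
  by apply: nE; exists a, b, c.
have [em me _] := lm; have [ey ye _] := corner_vP mc vy.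
have my : m * y = 0 by rewrite -me -mulrA ey mulr0.
exists a; move: E; rewrite (lie_lower lm) /lie_bracket my subr0 => E.
have h1 := congr1 ( *%R e) E; rewrite mulrA ey mul0r in h1.
have := congr1 ( *%R^~ e) E; rewrite -mulrA me E mulrDl mulrDl -!mulrA me ee => ->.
move: h1; rewrite !mulrDr !(mulrA e) -!sC -!mulrA em ee mulr0 add0r => h1.
by rewrite -addrA -(_ : 0 = s b * e + s c * e) ?addr0.
Qed.

End CentralScalars.

(** * From standard products to Lie isomorphisms *)

Lemma inj_surj_bij (T U : Type) (f : T -> U) :
  injective f -> (forall y, exists x, f x = y) -> bijective f.
Proof.
move=> fI fS; have [g gE] := choice fS.
by exists g => x; [apply: fI; rewrite gE|rewrite gE].
Qed.

(** Reduces an equation to another one by an identity between the differences. *)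
Lemma eq_from (A : zmodType) (x y l r : A) : l = r -> x - y = l - r -> x = y.
Proof. by move=> ->; rewrite subrr => /eqP; rewrite subr_eq0 => /eqP. Qed.

Section LieIsomorphism.
Context {F : numFieldType} {A1 A2 : pzRingType}.
Context (s1 : {rmorphism F -> A1}) (s2 : {rmorphism F -> A2}).
Hypothesis s1C : forall a x, s1 a * x = x * s1 a.
Hypothesis s2C : forall a x, s2 a * x = x * s2 a.
Hypothesis center1 : forall c, (forall x, c * x = x * c) -> exists a, c = s1 a.
Hypothesis center2 : forall c, (forall x, c * x = x * c) -> exists a, c = s2 a.
Hypothesis centroid1 : trivial_centroid s1 1.
Hypothesis standard2 : forall B : A2 -> A2 -> A2,
  equivariant_product B -> standard_product s2 B.
Hypothesis dichotomy2 :
  (exists x y z, forall a b c, [!y, [!x, z]] <> s2 a * x + s2 b * z + s2 c) \/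
  exists sg : A2 -> F, forall x y, exists t,
    x * y + y * x = s2 (sg x) * y + s2 (sg y) * x + s2 t.
Hypothesis noncomm2 : exists p q : A2, p * q <> q * p.
Variable Phi : A1 -> A2.
Hypothesis PhiD : {morph Phi : x y / x + y}.
Hypothesis PhiL : {morph Phi : x y / [!x, y] >-> [!x, y]}.
Hypothesis Phi_bij : bijective Phi.

(** If every y were in F x + F, the ring would be commutative. *)
Lemma independent_mod_center (x : A2) :
  exists y, forall a b c, s2 a * y + s2 b * x = s2 c -> a = 0.
Proof.
apply: contrapT => nind; have [p [q pq]] := noncomm2; apply: pq.
have dep y : exists b c, y = s2 b * x + s2 c.
  apply: contrapT => ny; apply: nind; exists y => a b c E.
  have [//|a0] := eqVneq a 0; case: ny.
  exists (- (a^-1 * b)), (a^-1 * c); have := congr1 ( *%R (s2 a^-1)) E.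
  rewrite mulrDr !mulrA -!rmorphM mulVf// rmorph1 mul1r => <-.
  by rewrite rmorphN mulNr addrC addrK.
have [b [c ->]] := dep p; have [d [f ->]] := dep q.
have xx : s2 b * x * (s2 d * x) = s2 d * x * (s2 b * x).
  rewrite -!mulrA !(mulrA x) -!s2C -!mulrA !(mulrA (s2 b)) (mulrA (s2 d)) -!mulrA.
  by rewrite (mulrA (s2 b)) s2C -!mulrA.
by rewrite !mulrDl !mulrDr xx !(s2C f) !(s2C c) addrACA -!addrA; congr (_ + _);
  rewrite !addrA (addrC (_ * s2 f)).
Qed.

Lemma noncentral : exists y : A2, forall a c, s2 a * y = s2 c -> a = 0.
Proof.
have [y yP] := independent_mod_center 0; exists y => a c E.
by apply: (yP a 0 c); rewrite mulr0 addr0.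
Qed.

(** The value of mu at x is determined as the coefficient of any element independent of x
    modulo the center, so identities of B pass to mu. *)
Lemma standard_product_additive B c mu : equivariant_product B ->
  (forall x y, exists t, B x y = s2 c * (x * y + y * x) + s2 (mu x) * y + s2 (mu y) * x +
    s2 t) ->
  {morph mu : x y / x + y} /\ forall x y, mu [!x, y] = 0.
Proof.
move=> eB BE; split=> [x x'|x z].
  have [z zP] := noncentral; have := ep_add eB x x' z.
  have [[[t0 E0] [t1 E1]] [t2 E2]] := (BE (x + x') z, BE x z, BE x' z).
  rewrite {}E0 {}E1 {}E2 => E.
  have : s2 (mu (x + x') - (mu x + mu x')) * z = s2 (t1 + t2 - t0).
    by apply: (eq_from E); rewrite !(rmorphD, rmorphN); ncring.
  by move=> /zP /eqP; rewrite subr_eq0 => /eqP->.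
have [y yP] := independent_mod_center x; have := ep_lie eB x y z.
have [[[t0 E0] [t1 E1]] [t2 E2]] := (BE x y, BE [!x, z] y, BE x [!y, z]).
rewrite {}E0 {}E1 {}E2 !lieDl !(lieZl s2C) (lie_scalar s2C).
rewrite (ep_lie jordan_equivariant) => E.
apply: (yP _ (mu [!y, z]) (- t1 - t2)); apply: (eq_from (esym E)).
rewrite !(rmorphD, rmorphN); ncring.
Qed.

(** The hypothesis says that B has the associator of a Jordan product.  Expanding it, the
    Jordan product enters only through its own associator with factor c^2, and the
    remaining terms are multiples of x and z and scalars. *)
Lemma standard_associator B c mu nu :
  (forall x y z, B (B x y) z - B x (B y z) = [!y, [!x, z]]) ->
  (forall x y, B x y =
    s2 c * (x * y + y * x) + s2 (mu x) * y + s2 (mu y) * x + s2 (nu x y)) ->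
  let al x y := c * nu x y + c * nu x y + mu (B x y) - mu x * mu y in
  forall x y z, exists d,
    s2 (1 - c * c) * [!y, [!x, z]] = s2 (al x y) * z - s2 (al y z) * x + s2 d.
Proof.
move=> assoc BE al x y z; have := assoc x y z; rewrite /al.
have := BE x y; have := BE y z; move: (B x y) (B y z) => w w' w'E wE.
rewrite (BE w z) (BE x w') => E.
exists (mu z * nu x y + nu w z - mu x * nu y z - nu x w').
have sA a b p : s2 a * (s2 b * p) = s2 (a * b) * p by rewrite mulrA -rmorphM.
have sCA p a q : p * (s2 a * q) = s2 a * (p * q) by rewrite mulrA -s2C mulrA.
have zw : z * w = s2 c * (z * (x * y + y * x)) + s2 (mu x) * (z * y) + s2 (mu y) * (z * x)
    + s2 (nu x y) * z.
  by rewrite wE 3!(mulrDr z) 3!sCA -s2C.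
have xw : x * w' = s2 c * (x * (y * z + z * y)) + s2 (mu y) * (x * z) + s2 (mu z) * (x * y)
    + s2 (nu y z) * x.
  by rewrite w'E 3!(mulrDr x) 3!sCA -s2C.
have wz : w * z = s2 c * ((x * y + y * x) * z) + s2 (mu x) * (y * z) + s2 (mu y) * (x * z)
    + s2 (nu x y) * z.
  by rewrite wE 3!(mulrDl _ _ z) -!mulrA.
have wx : w' * x = s2 c * ((y * z + z * y) * x) + s2 (mu y) * (z * x) + s2 (mu z) * (y * x)
    + s2 (nu y z) * x.
  by rewrite w'E 3!(mulrDl _ _ x) -!mulrA.
have mw : s2 (mu z) * w = s2 (c * mu z) * (x * y + y * x) + s2 (mu z * mu x) * y
    + s2 (mu z * mu y) * x + s2 (mu z * nu x y).
  by rewrite wE 3!(mulrDr (s2 (mu z))) !sA -rmorphM (mulrC c).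
have mx : s2 (mu x) * w' = s2 (c * mu x) * (y * z + z * y) + s2 (mu x * mu y) * z
    + s2 (mu z * mu x) * y + s2 (mu x * nu y z).
  by rewrite w'E 3!(mulrDr (s2 (mu x))) !sA -rmorphM (mulrC c) (mulrC (mu z)).
apply: (eq_from (esym E)); rewrite zw xw wz wx mw mx !(mulrDr (s2 c)) !sA (mulrC (mu y)
  (mu z)).
rewrite !(rmorphD, rmorphN) rmorph1 /lie_bracket; ncring.
Qed.

(** By [standard_associator] either c^2 = 1 or the second alternative of the dichotomy
    holds; in the latter case the Jordan product is a combination of the factors, and c
    can be moved to 1 at the expense of mu. *)
Lemma standard_product_unit B : equivariant_product B ->
  (forall x y z, B (B x y) z - B x (B y z) = [!y, [!x, z]]) ->
  exists (c : F) (mu : A2 -> F) (nu : A2 -> A2 -> F), (c = 1 \/ c = -1) /\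
  forall x y, B x y =
    s2 c * (x * y + y * x) + s2 (mu x) * y + s2 (mu y) * x + s2 (nu x y).
Proof.
move=> eB assoc; have [c [mu BE]] := standard2 eB.
have [nu nuE] : exists nu : A2 -> A2 -> F, forall x y, B x y =
    s2 c * (x * y + y * x) + s2 (mu x) * y + s2 (mu y) * x + s2 (nu x y).
  have [f fE] := choice (fun p : A2 * A2 => BE p.1 p.2).
  by exists (fun x y => f (x, y)) => x y; apply: (fE (x, y)).
have [cc|cc] := eqVneq (1 - c * c) 0.
  exists c, mu, nu; split=> //.
  have /eqP : (c - 1) * (c + 1) = 0 by rewrite -[RHS]oppr0 -cc; ring.
  by rewrite mulf_eq0 subr_eq0 addr_eq0 => /orP[]/eqP->; [left|right].
have [[x [y [z P]]]|[sg sgE]] := dichotomy2.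
  have [d E] := standard_associator assoc nuE x y z.
  move: E; set a := _ - mu x * mu y; set b := _ - mu y * mu z => E.
  case: (P (- ((1 - c * c)^-1 * b)) ((1 - c * c)^-1 * a) ((1 - c * c)^-1 * d)).
  have := congr1 ( *%R (s2 (1 - c * c)^-1)) E.
  rewrite mulrA -rmorphM mulVf// rmorph1 mul1r => ->.
  by rewrite !(rmorphM, rmorphN); ncring.
have [ta taE] : exists ta : A2 -> A2 -> F, forall x y,
    x * y + y * x = s2 (sg x) * y + s2 (sg y) * x + s2 (ta x y).
  have [f fE] := choice (fun p : A2 * A2 => sgE p.1 p.2).
  by exists (fun x y => f (x, y)) => x y; apply: (fE (x, y)).
exists 1, (fun x => mu x + (c - 1) * sg x), (fun x y => nu x y + (c - 1) * ta x y).
split; first by left.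
move=> x y; rewrite nuE.
have -> : s2 c * (x * y + y * x) = s2 1 * (x * y + y * x) + s2 (c - 1) * (x * y + y * x).
  by rewrite !rmorphD rmorphN; ncring.
rewrite {2}taE !(rmorphD, rmorphM, rmorphN); ncring.
Qed.

(** S x = c x + m x with m = mu / 2 satisfies S (B x y) = S x o S y and
    S [x, y] = c [x, y] = c [S x, S y], hence Theta = S Phi satisfies
    2 Theta (a b) = Theta a o Theta b + c [Theta a, Theta b]. *)
Theorem lie_isomorphism_standard :
  exists (Psi : A1 -> A2) (h : A1 -> F),
    [/\ ring_isomorphism Psi \/
          (exists Theta : A1 -> A2,
             ring_antiisomorphism Theta /\ forall a, Psi a = - Theta a),
        {morph h : a b / a + b}, forall a b, h [!a, b] = 0
      & forall a, Phi a = Psi a + s2 (h a)].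
Proof.
have [G GK KG] := Phi_bij.
have Phi_inj := bij_inj Phi_bij.
have GD : {morph G : x y / x + y} by move=> x y; apply: Phi_inj; rewrite PhiD !KG.
have GL : {morph G : x y / [!x, y] >-> [!x, y]}.
  by move=> x y; apply: Phi_inj; rewrite PhiL !KG.
have Phi0 : Phi 0 = 0 by apply: (addrI (Phi 0)); rewrite -PhiD !addr0.
have PhiN a : Phi (- a) = - Phi a.
  by apply: (addrI (Phi a)); rewrite -PhiD !subrr.
pose B x y := Phi (G x * G y + G y * G x).
have eB : equivariant_product B.
  split=> [x y|x y z|x y z]; first by rewrite /B addrC.
    by rewrite /B GD (ep_add jordan_equivariant) PhiD.
  rewrite /B -{1}(KG z) -PhiL (ep_lie jordan_equivariant) PhiD !GL //.
have assoc x y z : B (B x y) z - B x (B y z) = [!y, [!x, z]].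
  have -> : [!y, [!x, z]] = Phi [!G y, [!G x, G z]] by rewrite !PhiL !KG.
  by rewrite /B -PhiN -PhiD !GK; congr Phi; rewrite /lie_bracket; ncring.
have [c [mu [nu [c1 BE]]]] := standard_product_unit eB assoc.
have cc : c * c = 1 by case: c1 => ->; rewrite ?mulrNN mulr1.
have [muD mu_lie] : {morph mu : x y / x + y} /\ forall x y, mu [!x, y] = 0.
  by apply: (standard_product_additive eB (c := c)) => x y; exists (nu x y).
have muB x y : mu (B x y) = mu x * mu y - (c * nu x y + c * nu x y).
  have [z zP] := independent_mod_center x.
  have [d] := standard_associator assoc BE x y z.
  rewrite cc subrr rmorph0 mul0r; set b := _ - mu y * mu z => E.
  have : c * nu x y + c * nu x y + mu (B x y) - mu x * mu y = 0.
    apply: (zP _ (- b) (- d)); apply: (eq_from (esym E)).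
    rewrite !(rmorphD, rmorphN); ncring.
  by move=> h; apply: (eq_from h); ring.
have [m [mE mD m_lie]] : exists m : A2 -> F, [/\ forall x, mu x = m x + m x,
    {morph m : x y / x + y} & forall x y, m [!x, y] = 0].
  exists (fun x => mu x / 2); split=> [x|x y|x y]; first by field.
    by rewrite muD mulrDl.
  by rewrite mu_lie mul0r.
pose S x := s2 c * x + s2 (m x).
have SD : {morph S : x y / x + y} by move=> x y; rewrite /S mD rmorphD; ncring.
have S_lie x y : S [!x, y] = s2 c * [!x, y] by rewrite /S m_lie rmorph0 addr0.
have S_comm x y : [!S x, S y] = [!x, y].
  rewrite /S lieDl (lie_scalar s2C) addr0 (lieZl s2C) lieC lieDl (lie_scalar s2C) addr0.
  by rewrite (lieZl s2C) -mulrN -lieC mulrA -rmorphM cc rmorph1 mul1r.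
have S_jordan x y : S (B x y) = S x * S y + S y * S x.
  have hm : m (B x y) = m x * m y + m x * m y - c * nu x y.
    have h2 : (2 : F) != 0 by rewrite pnatr_eq0.
    by apply: (mulIf h2); have := muB x y; rewrite !mE => h; apply: (eq_from h); ring.
  have prod p q : S p * S q = s2 (c * c) * (p * q) + s2 (c * m q) * p + s2 (c * m p) * q
      + s2 (m p * m q).
    have pq : p * (s2 c * q) = s2 c * (p * q) by rewrite mulrA -s2C mulrA.
    rewrite /S mulrDl !mulrDr -(s2C _ (s2 c * p)) -!mulrA pq !(mulrA (s2 _) (s2 _)).
    by rewrite -!rmorphM (mulrC (m q)) (mulrC (m p) c) !addrA.
  rewrite !prod {1}/S hm (BE x y) (mE x) (mE y) !(mulrDr (s2 c)) !(mulrA (s2 c)) -!rmorphM.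
  rewrite (mulrC (m y) (m x)) !(rmorphD, rmorphN, mulrDr c, mulrDl); ncring.
pose Theta a := S (Phi a).
have ThetaD : {morph Theta : a b / a + b} by move=> a b; rewrite /Theta PhiD SD.
have double (x y : A2) : x + x = y + y -> x = y.
  move=> xy; apply/eqP; rewrite -subr_eq0; apply/eqP; apply: (double_eq0 s2).
  by apply: (eq_from xy); ncring.
have ThetaM a b : Theta (a * b) + Theta (a * b) =
    Theta a * Theta b + Theta b * Theta a + s2 c * [!Theta a, Theta b].
  rewrite -ThetaD (_ : a * b + a * b = (a * b + b * a) + [!a, b]); last first.
    by rewrite /lie_bracket; ncring.
  rewrite ThetaD /Theta PhiL S_lie -S_comm; congr (_ + _).
  by rewrite -S_jordan /B !GK.
have scalar_Phi k : exists d, Phi (s1 k) = s2 d.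
  by apply: center2 => x; rewrite -(KG x); apply/eqP;
    rewrite -subr_eq0 -[X in X == _]PhiL /lie_bracket s1C subrr Phi0.
have [y0 y0P] := noncentral.
have c0 : c != 0 by apply/eqP => c0; move: cc; rewrite c0 mulr0 => /esym/eqP;
  rewrite oner_eq0.
have Sy0 k d : s2 k * S y0 = s2 d -> k = 0.
  move=> E; have /y0P/eqP : s2 (k * c) * y0 = s2 (d - k * m y0).
    by apply: (eq_from E); rewrite /S mulrDr mulrA rmorphD rmorphN !rmorphM; ncring.
  by rewrite mulf_eq0 (negPf c0) orbF => /eqP.
have S_scalar d : S (s2 d) = s2 (c * d + m (s2 d)) by rewrite /S rmorphD rmorphM.
have scalar_mul k a : Theta (s1 k * a) = Theta (s1 k) * Theta a.
  have [d kd] := scalar_Phi k; apply: double.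
  rewrite ThetaM /Theta kd S_comm (lie_scalar s2C) mulr0 addr0; congr (_ + _).
  by rewrite S_scalar s2C.
have Theta_inj : injective Theta.
  move=> a b ab; apply/eqP; rewrite -subr_eq0; apply/eqP.
  have Tab : Theta (a - b) = 0.
    by apply: (addIr (Theta b)); rewrite -ThetaD subrK add0r.
  have [d Pab] : exists d, Phi (a - b) = s2 d.
    exists (- (c * m (Phi (a - b)))); move: Tab; rewrite /Theta /S.
    move/(congr1 ( *%R (s2 c))); rewrite mulr0 mulrDr mulrA -!rmorphM cc rmorph1 mul1r =>
      /eqP.
    by rewrite addr_eq0 rmorphN => /eqP.
  have [k kE] : exists k, a - b = s1 k.
    apply: center1 => x; apply: Phi_inj; apply/eqP; rewrite -subr_eq0 -PhiN -PhiD.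
    by rewrite [X in Phi X](_ : _ = [!a - b, x])// PhiL Pab (lie_scalar s2C).
  have [k0|k0] := eqVneq k 0; first by rewrite kE k0 rmorph0.
  have T1 : Theta (G y0) = 0.
    have -> : G y0 = s1 k * (s1 k^-1 * G y0).
      by rewrite mulrA -rmorphM mulfV// rmorph1 mul1r.
    by rewrite scalar_mul -kE Tab mul0r.
  suff /eqP : (1 : F) = 0 by rewrite oner_eq0.
  by apply: (Sy0 1 0); rewrite -{1}(KG y0) -/(Theta _) T1 mulr0 rmorph0.
(* multiplication by k, carried to A1, is in the centroid, hence multiplication by
   some k1 up to scalars; Theta then maps k1 to k *)
have scalar_in_image k : exists a, Theta a = s2 k.
  have u1 (x : A1) : corner 1 x by split; rewrite ?mul1r ?mulr1.
  have [//|a b _ _|a b _ _|k1 [eta kE]] := centroid1 (T := fun a => G (s2 k * Phi a)).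
  - by rewrite PhiD mulrDr GD.
  - by rewrite PhiL -(lieZl s2C) GL GK.
  have := kE (G y0) (u1 _); rewrite KG mulr1 => /(congr1 Phi); rewrite KG PhiD.
  have [d1 ->] := scalar_Phi (eta (G y0)) => E.
  have [d kd] := scalar_Phi k1.
  exists (s1 k1); rewrite /Theta kd S_scalar; congr (s2 _); apply/eqP; rewrite -subr_eq0;
    apply/eqP.
  have := scalar_mul k1 (G y0); rewrite /Theta KG kd S_scalar => h.
  apply: (Sy0 _ (m (s2 k * y0 - s2 d1) - c * d1 - k * m y0)).
  rewrite rmorphB mulrBl -h (_ : Phi (s1 k1 * G y0) = s2 k * y0 - s2 d1).
    rewrite /S !(rmorphD, rmorphN, rmorphM) !mulrDr !(mulrA (s2 k)) -(rmorphM s2 k c) mulrC.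
    rewrite rmorphM; ncring.
  by rewrite E addrK.
have Theta_surj y : exists a, Theta a = y.
  have [a aE] := scalar_in_image (m (s2 c * y)).
  exists (G (s2 c * y) - a); rewrite /Theta; apply: (addIr (Theta a)).
  by rewrite -ThetaD subrK aE /Theta KG /S mulrA -rmorphM cc rmorph1 mul1r.
have Theta_bij := inj_surj_bij Theta_inj Theta_surj.
have PhiE a : s2 c * Phi a = Theta a - s2 (m (Phi a)) by rewrite /Theta /S addrK.
case: c1 => cE; move: PhiE ThetaM; rewrite cE ?rmorphN rmorph1 => PhiE ThetaM.
- exists Theta, (fun a => - m (Phi a)); split.
  + left; split=> // a b; apply: double; rewrite ThetaM /lie_bracket; ncring.
  + by move=> a b; rewrite PhiD mD opprD.
  + by move=> a b; rewrite PhiL m_lie oppr0.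
  + by move=> a; rewrite rmorphN -PhiE mul1r.
exists (fun a => - Theta a), (fun a => m (Phi a)); split.
- right; exists Theta; split=> //; split=> // a b; apply: double.
  rewrite ThetaM /lie_bracket; ncring.
- by move=> a b; rewrite PhiD mD.
- by move=> a b; rewrite PhiL m_lie.
- by move=> a; have := PhiE a; rewrite mulN1r => h; apply: (eq_from (esym h)); ncring.
Qed.

End LieIsomorphism.

(** Here Phi is only an additive bijection of the field, usually not multiplicative: Psi
    is the identification of the scalars, and h absorbs Phi. *)
Lemma scalar_lie_isomorphism (F : numFieldType) (A1 A2 : pzRingType)
    (s1 : {rmorphism F -> A1}) (s2 : {rmorphism F -> A2}) (Phi : A1 -> A2) :
  (forall x, exists t, x = s1 t) -> (forall x, exists t, x = s2 t) ->
  {morph Phi : x y / x + y} -> bijective Phi ->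
  exists (Psi : A1 -> A2) (h : A1 -> F),
    [/\ ring_isomorphism Psi, {morph h : a b / a + b}, forall a b, h [!a, b] = 0
      & forall a, Phi a = Psi a + s2 (h a)].
Proof.
move=> sc1 sc2 PhiD Phi_bij; have [G GK KG] := Phi_bij.
have s_inj (A : pzRingType) (s : {rmorphism F -> A}) : (1 : A) <> 0 -> injective s.
  move=> n1 t t' tt'; apply/eqP; rewrite -subr_eq0; apply/eqP; apply: contrapT => /eqP d0.
  by apply: n1; rewrite -(rmorph1 s) -(mulVf d0) rmorphM rmorphB tt' subrr mulr0.
have Phi0 : Phi 0 = 0 by apply: (addrI (Phi 0)); rewrite -PhiD !addr0.
have [n2|t2] := pselect ((1 : A2) <> 0); last first.
  have z2 (x : A2) : x = 0.
    by rewrite -(mul1r x) (_ : 1 = 0) ?mul0r//; apply: contrapT.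
  exists Phi, (fun _ => 0); split=> //; last by move=> a; rewrite [LHS]z2 [RHS]z2.
    by split=> // a b; rewrite [LHS]z2 [RHS]z2.
  by move=> a b; rewrite addr0.
have n1 : (1 : A1) <> 0.
  move=> e; apply: n2; rewrite -(KG 1) -Phi0; congr Phi.
  by rewrite -(mul1r (G 1)) e mul0r.
have [c1 c1E] := choice sc1; have [c2 c2E] := choice sc2.
have [I1 I2] := (s_inj _ s1 n1, s_inj _ s2 n2).
have s1K t : c1 (s1 t) = t by apply: I1; rewrite -c1E.
have s2K t : c2 (s2 t) = t by apply: I2; rewrite -c2E.
have c1D a b : c1 (a + b) = c1 a + c1 b by apply: I1; rewrite rmorphD -!c1E.
have c2D a b : c2 (a + b) = c2 a + c2 b by apply: I2; rewrite rmorphD -!c2E.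
exists (fun a => s2 (c1 a)), (fun a => c2 (Phi a) - c1 a); split.
- split=> [a b|a b|]; first by rewrite c1D rmorphD.
    by rewrite -rmorphM; congr (s2 _); apply: I1; rewrite rmorphM -!c1E.
  by exists (fun b => s1 (c2 b)) => a; rewrite ?s1K ?s2K -?c1E -?c2E.
- by move=> a b; rewrite PhiD c1D c2D; ring.
- move=> a b; have -> : [!a, b] = s1 0.
    by rewrite (c1E a) (c1E b) /lie_bracket -!rmorphM mulrC subrr rmorph0.
  by rewrite s1K rmorph0 Phi0 -(rmorph0 s2) s2K subrr.
- by move=> a; rewrite -rmorphD addrC subrK -c2E.
Qed.

Lemma standard_form_lie (F : numFieldType) (A1 A2 : pzRingType)
    (s2 : {rmorphism F -> A2}) (s2C : forall a x, s2 a * x = x * s2 a)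
    (Phi Psi : A1 -> A2) (h : A1 -> F) :
  ring_isomorphism Psi \/ (exists Theta : A1 -> A2,
     ring_antiisomorphism Theta /\ forall a, Psi a = - Theta a) ->
  {morph h : a b / a + b} -> (forall a b, h [!a, b] = 0) ->
  (forall a, Phi a = Psi a + s2 (h a)) -> bijective Phi -> lie_ring_isomorphism Phi.
Proof.
move=> PsiP hD hL PhiE Phi_bij.
have [PsiD PsiL] : {morph Psi : a b / a + b} /\ {morph Psi : a b / [!a, b] >-> [!a, b]}.
  case: PsiP => [[PsiD PsiM _]|[Theta [[TD TM _] PsiE]]].
    have PsiN a : Psi (- a) = - Psi a.
      have P0 : Psi 0 = 0 by apply: (addrI (Psi 0)); rewrite -PsiD !addr0.
      by apply: (addrI (Psi a)); rewrite -PsiD !subrr.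
    by split=> // a b; rewrite /lie_bracket PsiD PsiN !PsiM.
  have TN a : Theta (- a) = - Theta a.
    have P0 : Theta 0 = 0 by apply: (addrI (Theta 0)); rewrite -TD !addr0.
    by apply: (addrI (Theta a)); rewrite -TD !subrr.
  split=> a b; rewrite !PsiE; first by rewrite TD opprD.
  by rewrite /lie_bracket TD TN !TM; ncring.
split=> // a b; rewrite !PhiE; first by rewrite PsiD hD rmorphD addrACA.
rewrite PsiL hL rmorph0 addr0 (lieDl (Psi a)) (lie_scalar s2C) addr0.
by rewrite lieC (lieC (Psi a)) (lieDl (Psi b)) (lie_scalar s2C) addr0.
Qed.


(** * Bounded operators and functionals *)

Section OperatorFacts.
Context {K : numFieldType} {X : normedModType K}.

Lemma bounded_op_closed_preim (T : bounded_op X) (V : set X) :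
  closed V -> closed [set v | V (T v)].
Proof.
move=> clV v clv; apply: clV => B /nbhs_ballP[e /= e0 sub].
have [M M0 TM] : exists2 M : K, 0 < M & forall x, `|T x| <= M * `|x|.
  have /asboolP[_ [c Tc]] := op_bounded T.
  have [[x0 Tx0]|T0] := pselect (exists x, T x != 0).
    have x0n : 0 < `|x0|.
      rewrite normr_gt0; apply: contra_neq Tx0 => ->.
      by have := bounded_op_linear T (-1) 0 0; rewrite !scaleN1r !addNr.
    exists c => //; rewrite -(pmulr_lgt0 _ x0n); apply: lt_le_trans (Tc _).
    by rewrite normr_gt0.
  exists 1 => // x; have [->|Tx] := eqVneq (T x) 0; last by case: T0; exists x.
  by rewrite normr0 mul1r.
have [w [Vw vw]] := clv _ (nbhsx_ballx v (e / M) (divr_gt0 e0 M0)).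
exists (T w); split => //; apply: sub; rewrite -ball_normE /=.
have -> : T v - T w = T (v - w).
  by have := bounded_op_linear T (-1) w v; rewrite !scaleN1r ![- _ + _]addrC => ->.
apply: le_lt_trans (TM _) _; rewrite mulrC -ltr_pdivlMr//.
by move: vw; rewrite -ball_normE.
Qed.

Lemma closed_span_sub (S V : set X) :
  is_subspace V -> closed V -> S `<=` V -> closed_span S `<=` V.
Proof.
move=> sV cV SV v clv; apply: cV; apply: closure_subset clv.
by apply: smallest_sub.
Qed.

Lemma sub_closed_span (S : set X) : S `<=` closed_span S.
Proof. by move=> v Sv; apply: subset_closure; apply: sub_gen_smallest. Qed.

Lemma bounded_functional_lin (f : X -> K) a x y : bounded_functional f ->
  f (a *: x + y) = a * f x + f y.
Proof. by move=> [lf _]; apply: lf. Qed.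

Lemma bfD (f : X -> K) x y : bounded_functional f -> f (x + y) = f x + f y.
Proof. by move=> bf; rewrite -[x in LHS]scale1r bounded_functional_lin// mul1r. Qed.
Lemma bf0 (f : X -> K) : bounded_functional f -> f 0 = 0.
Proof. by move=> bf; apply: (addrI (f 0)); rewrite -bfD// !addr0. Qed.
Lemma bfZ (f : X -> K) a x : bounded_functional f -> f (a *: x) = a * f x.
Proof. by move=> bf; rewrite -[a *: x]addr0 bounded_functional_lin// bf0// addr0. Qed.
Lemma bfN (f : X -> K) x : bounded_functional f -> f (- x) = - f x.
Proof. by move=> bf; rewrite -scaleN1r bfZ// mulN1r. Qed.
Lemma bfB (f : X -> K) x y : bounded_functional f -> f (x - y) = f x - f y.
Proof. by move=> bf; rewrite bfD// bfN. Qed.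

Lemma bounded_functional_ge0 (f : X -> K) : bounded_functional f ->
  exists2 c, 0 <= c & forall x, `|f x| <= c * `|x|.
Proof.
move=> bf; have [_ [c fc]] := bf.
have [[x0 fx0]|f0] := pselect (exists x, f x != 0).
  have x0n : 0 < `|x0| by rewrite normr_gt0; apply: contra_neq fx0 => ->; exact: bf0.
  by exists c => //; rewrite -(pmulr_lge0 _ x0n); apply: le_trans (fc _).
exists 0 => // x; have [->|fx] := eqVneq (f x) 0; last by case: f0; exists x.
by rewrite normr0 mul0r.
Qed.

Lemma bounded_functional_comp (f : X -> K) (T : bounded_op X) :
  bounded_functional f -> bounded_functional (fun v => f (T v)).
Proof.
move=> bf; have [c c0 fc] := bounded_functional_ge0 bf; split.
  by move=> a x y; rewrite bounded_op_linear bounded_functional_lin.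
have /asboolP[_ [d Td]] := op_bounded T.
exists (c * d) => x; apply: le_trans (fc _) _.
by rewrite -mulrA ler_wpM2l.
Qed.

Lemma bounded_functionalD (f g : X -> K) : bounded_functional f ->
  bounded_functional g -> bounded_functional (fun v => f v + g v).
Proof.
move=> bf bg; have [[_ [c fc]] [_ [d gd]]] := (bf, bg); split.
  by move=> a x y; rewrite !bounded_functional_lin//= mulrDr addrACA.
by exists (c + d) => x; rewrite mulrDl; apply: le_trans (ler_normD _ _) _; apply: lerD.
Qed.

Lemma bounded_functionalZ (f : X -> K) a : bounded_functional f ->
  bounded_functional (fun v => a * f v).
Proof.
move=> bf; have [_ [c fc]] := bf; split.
  by move=> b x y; rewrite bounded_functional_lin//= mulrDr mulrCA.
by exists (`|a| * c) => x; rewrite normrM -mulrA ler_wpM2l.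
Qed.

Lemma rank_one_bounded (p : X) (f : X -> K) : bounded_functional f ->
  (fun v => f v *: p) \in @bounded_operator K X.
Proof.
move=> bf; have [_ [c fc]] := bf; apply/asboolP; split.
  by move=> a x y; rewrite bounded_functional_lin// scalerDl scalerA.
by exists (c * `|p|) => x; rewrite normrZ mulrAC ler_wpM2r.
Qed.

End OperatorFacts.

(** * Rank-one operators of a nest algebra *)

Section NestAlgebra.
Context {K : numFieldType} {X : normedModType K} (N : nest X).
Hypothesis sepX : separating X.
Local Notation A := (nest_alg N).
Local Notation nst := (nest_set N).
Implicit Types (a b c x y r : A) (f g k : X -> K) (U V W : set X) (p q v w : X).

Lemma opD a b v : (a + b) v = a v + b v. Proof. by []. Qed.
Lemma opN a v : (- a) v = - a v. Proof. by []. Qed.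
Lemma opB a b v : (a - b) v = a v - b v. Proof. by []. Qed.
Lemma opM a b v : (a * b) v = a (b v). Proof. by []. Qed.
Lemma opZ (t : K) a v : (t *: a) v = t *: a v. Proof. by []. Qed.
Lemma op1 v : (1 : A) v = v. Proof. by []. Qed.
Lemma op0 v : (0 : A) v = 0. Proof. by []. Qed.

Lemma op_ext a b : (forall v, a v = b v) -> a = b.
Proof. by move=> ab; apply: val_inj; apply: bounded_opP. Qed.

Lemma op_addv a v w : a (v + w) = a v + a w.
Proof. by have := bounded_op_linear a 1 v w; rewrite !scale1r. Qed.
Lemma op_v0 a : a 0 = 0.
Proof. by apply: (addrI (a 0)); rewrite -op_addv !addr0. Qed.
Lemma op_scalev a (t : K) v : a (t *: v) = t *: a v.
Proof. by have := bounded_op_linear a t v 0; rewrite !addr0 op_v0 addr0. Qed.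
Lemma op_oppv a v : a (- v) = - a v.
Proof. by rewrite -scaleN1r op_scalev scaleN1r. Qed.
Lemma op_subv a v w : a (v - w) = a v - a w.
Proof. by rewrite op_addv op_oppv. Qed.

Definition scalar_op (t : K) : A := t *: (1 : A).

Lemma scalar_opE t v : scalar_op t v = t *: v. Proof. by []. Qed.

Lemma scalar_op_additive : {morph scalar_op : t s / t - s}.
Proof. by move=> t s; apply: op_ext => v; rewrite opB !scalar_opE scalerBl. Qed.
Lemma scalar_op_monoid : monoid_morphism scalar_op.
Proof.
split=> [|t s]; apply: op_ext => v; first by rewrite scalar_opE scale1r.
by rewrite opM !scalar_opE scalerA.
Qed.
HB.instance Definition _ := GRing.isZmodMorphism.Build K A scalar_op scalar_op_additive.
HB.instance Definition _ := GRing.isMonoidMorphism.Build K A scalar_op scalar_op_monoid.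

Lemma scalar_opM t a : scalar_op t * a = t *: a.
Proof. exact: op_ext. Qed.

Lemma scalar_opC t a : scalar_op t * a = a * scalar_op t.
Proof. by apply: op_ext => v; rewrite !opM !scalar_opE op_scalev. Qed.

Lemma nest_sub V a v : nst V -> V v -> V (a v).
Proof. by move=> NV Vv; have /asboolP h := nest_algP a; apply: (h V NV); exists v. Qed.

Lemma nest_subspace V : nst V -> is_subspace V.
Proof. by have [+ _ _ _ _] := nestP N => /[apply] -[]. Qed.
Lemma nest_closed V : nst V -> closed V.
Proof. by have [+ _ _ _ _] := nestP N => /[apply] -[]. Qed.
Lemma nest_total U V : nst U -> nst V -> U `<=` V \/ V `<=` U.
Proof. by have [_ + _ _ _] := nestP N; apply. Qed.
Lemma nest0 : nst [set 0]. Proof. by have [_ _ [+ _] _ _] := nestP N. Qed.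
Lemma subspaceD V v w : is_subspace V -> V v -> V w -> V (v + w).
Proof. by move=> [_ VV] Vv Vw; rewrite -[v]scale1r; apply: VV. Qed.
Lemma subspaceZ V (t : K) v : is_subspace V -> V v -> V (t *: v).
Proof. by move=> [V0 VV] Vv; rewrite -[_ *: _]addr0; apply: VV. Qed.
Lemma subspaceB V v w : is_subspace V -> V v -> V w -> V (v - w).
Proof. by move=> sV Vv Vw; apply: subspaceD => //; rewrite -scaleN1r; apply: subspaceZ. Qed.

(** The rank-one operator of p and f leaves each member of the nest invariant. *)
Definition admissible p f := bounded_functional f /\
  forall V, nst V -> V p \/ forall v, V v -> f v = 0.

Lemma rank_one_exists p f : admissible p f -> exists r : A, forall v, r v = f v *: p.
Proof.
move=> [bf adm]; suff rN : BoundedOp (rank_one_bounded p bf) \in Alg N.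
  by exists (NestAlg rN).
apply/asboolP => V NV _ [v Vv <-] /=; have [Vp|f0] := adm V NV.
  by apply: subspaceZ => //; apply: nest_subspace.
by rewrite f0// scale0r; have [] := nest_subspace NV.
Qed.

(** Total in p and f, so that membership in the algebra stays a side condition. *)
Definition rank_one p f : A :=
  if pselect (admissible p f) is left h then sval (cid (rank_one_exists h)) else 0.

Lemma rank_oneE p f v : admissible p f -> rank_one p f v = f v *: p.
Proof.
move=> h; rewrite /rank_one; case: pselect => // h'.
exact: (svalP (cid (rank_one_exists h'))).
Qed.

Lemma admissible_op p f x : admissible p f -> admissible (x p) f.
Proof. by move=> [bf h]; split=> // V NV; case: (h V NV); [left;
  exact: nest_sub|right]. Qed.
Lemma admissible_comp p f x : admissible p f -> admissible p (fun v => f (x v)).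
Proof.
move=> [bf h]; split; first exact: bounded_functional_comp.
by move=> V NV; case: (h V NV) => [|f0]; [left|right=> v Vv; apply: f0; exact: nest_sub].
Qed.
Lemma admissibleDl p q f : admissible p f -> admissible q f -> admissible (p + q) f.
Proof.
move=> [bf h] [_ h']; split=> // V NV; case: (h V NV) => [Vp|]; last by right.
case: (h' V NV) => [Vq|]; last by right.
by left; apply: subspaceD => //; exact: nest_subspace.
Qed.
Lemma admissibleZl p f (t : K) : admissible p f -> admissible (t *: p) f.
Proof.
move=> [bf h]; split=> // V NV; case: (h V NV) => [Vp|]; last by right.
by left; apply: subspaceZ => //; exact: nest_subspace.
Qed.

Lemma mul_rank_one x p f : admissible p f -> x * rank_one p f = rank_one (x p) f.
Proof.
move=> h; apply: op_ext => v; rewrite opM !rank_oneE//; last exact: admissible_op.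
by rewrite op_scalev.
Qed.
Lemma rank_one_mul x p f : admissible p f ->
  rank_one p f * x = rank_one p (fun v => f (x v)).
Proof. by move=> h; apply: op_ext => v; rewrite opM !rank_oneE//;
  exact: admissible_comp. Qed.


Lemma admissibleDr p f g : admissible p f -> admissible p g ->
  admissible p (fun v => f v + g v).
Proof.
move=> [bf h] [bg h']; split; first exact: bounded_functionalD.
move=> V NV; case: (h V NV) => [|f0]; first by left.
by case: (h' V NV) => [|g0]; [left|right=> v Vv; rewrite f0// g0// addr0].
Qed.
Lemma admissibleZr p f (t : K) : admissible p f -> admissible p (fun v => t * f v).
Proof.
move=> [bf h]; split; first exact: bounded_functionalZ.
by move=> V NV; case: (h V NV) => [|f0]; [left|right=> v Vv; rewrite f0// mulr0].
Qed.

Lemma rank_oneDl p q f : admissible p f -> admissible q f ->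
  rank_one (p + q) f = rank_one p f + rank_one q f.
Proof.
move=> ap aq; apply: op_ext => v; rewrite opD !rank_oneE ?scalerDr//.
exact: admissibleDl.
Qed.
Lemma rank_oneDr p f g : admissible p f -> admissible p g ->
  rank_one p (fun v => f v + g v) = rank_one p f + rank_one p g.
Proof.
move=> af ag; apply: op_ext => v; rewrite opD !rank_oneE ?scalerDl//.
exact: admissibleDr.
Qed.
Lemma rank_oneZl p f (t : K) : admissible p f -> rank_one (t *: p) f = t *: rank_one p f.
Proof.
move=> af; apply: op_ext => v; rewrite opZ !rank_oneE ?scalerA 1?mulrC//.
exact: admissibleZl.
Qed.
Lemma rank_oneZr p f (t : K) : admissible p f ->
  rank_one p (fun v => t * f v) = t *: rank_one p f.
Proof.
move=> af; apply: op_ext => v; rewrite opZ !rank_oneE ?scalerA//.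
exact: admissibleZr.
Qed.
Lemma rank_one_zero p f : (forall v, f v = 0) -> admissible p f -> rank_one p f = 0.
Proof. by move=> f0 af; apply: op_ext => v; rewrite rank_oneE// f0 scale0r. Qed.

(** * The nest below an idempotent: atoms and limits *)

Definition range_of (u : A) : set X := [set v | u v = v].

(** The corner of such an idempotent u behaves like the nest algebra of its range W, with
    respect to the members of the nest contained in W together with W itself. *)
Definition comparable (u : A) := u * u = u /\
  forall V, nst V -> V `<=` range_of u \/ range_of u `<=` V.

Definition below (u : A) V := [/\ nst V, V `<=` range_of u & ~ range_of u `<=` V].

(** The functional g kills all members of the nest strictly below the range of u. *)
Definition atom_at (u : A) p g := [/\ u p = p, bounded_functional g,
  forall v, g (u v) = g v, g p = 1
  & forall V, nst V ->
      range_of u `<=` V \/ V `<=` range_of u /\ forall v, V v -> g v = 0].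

(** The members of the nest strictly below the range of u have no largest element and
    are jointly dense in it; density is stated through the operators that they detect. *)
Definition limit_at (u : A) := [/\ forall V, below u V ->
    exists V', [/\ below u V', V `<=` V' & ~ V' `<=` V],
  forall a, (forall V v, below u V -> V v -> a v = 0) -> forall v, u v = v -> a v = 0
  & below u [set 0]].

Lemma kernel_subspace a : is_subspace [set v | a v = 0].
Proof.
split; first exact: op_v0.
by move=> t v w /= av aw; rewrite op_addv op_scalev av aw scaler0 addr0.
Qed.

Lemma kernel_closed a : closed [set v | a v = 0].
Proof. exact: (bounded_op_closed_preim (T := a) (nest_closed nest0)). Qed.

Lemma range_ofE u : range_of u = [set v | (1 - u) v = 0].
Proof.
apply/seteqP; split=> v.
  by change (u v = v -> (1 - u) v = 0); rewrite opB op1 => ->; rewrite subrr.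
change ((1 - u) v = 0 -> u v = v); rewrite opB op1 => /eqP.
by rewrite subr_eq0 => /eqP.
Qed.

Lemma range_subspace u : is_subspace (range_of u).
Proof. by rewrite range_ofE; apply: kernel_subspace. Qed.
Lemma range_closed u : closed (range_of u).
Proof. by rewrite range_ofE; apply: kernel_closed. Qed.

Lemma comparable1 : comparable 1.
Proof. by split; [rewrite mulr1|move=> V _; left]. Qed.

(** The closed span L of the members strictly below the range is a member of the nest.
    Either some p of the range is outside L, and a functional separates p from L, or the
    range is L, and a largest member strictly below it would contain L. *)
Lemma nest_dichotomy u : comparable u ->
  [\/ u = 0, exists p g, atom_at u p g | limit_at u].
Proof.
move=> [uu cmp].
pose L := closed_span (\bigcup_(V in below u) V).
have NL : nst L by have [_ _ _ + _] := nestP N; apply=> V [].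
have LW : L `<=` range_of u.
  apply: closed_span_sub; [exact: range_subspace|exact: range_closed|].
  by move=> v [V [_ VW _] Vv]; apply: VW.
have VL V : below u V -> V `<=` L.
  by move=> bV v Vv; apply: sub_closed_span; exists V.
have [[p [up Lp]]|all] := pselect (exists p, u p = p /\ ~ L p).
  apply: Or32; have [f [bf fL fp]] := sepX (nest_subspace NL) (nest_closed NL) Lp.
  exists p, (fun v => f (u v)); split=> //.
  - exact: bounded_functional_comp.
  - by move=> v; rewrite -opM uu.
  - by rewrite up.
  - move=> V NV; have [WV|WV] := pselect (range_of u `<=` V); first by left.
    have [VW|//] := cmp V NV; right; split=> // v Vv.
    by rewrite (VW _ Vv) fL//; apply: (VL V).
have WL : range_of u `<=` L by move=> v uv; apply: contrapT => Lv; apply: all; exists v.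
have [u0|un0] := pselect (u = 0); first exact: Or31.
apply: Or33; split.
- move=> V bV; apply: contrapT => nV'; have [NV VW nWV] := bV; apply: nWV.
  apply: (subset_trans WL); apply: closed_span_sub;
    [exact: nest_subspace|exact: nest_closed|].
  move=> v [V' bV' V'v]; apply: contrapT => Vv; apply: nV'.
  have nV'V : ~ V' `<=` V by move=> /(_ _ V'v).
  by exists V'; split=> //; have [NV' _ _] := bV'; have [|/nV'V//] := nest_total NV NV'.
- move=> a a0 v uv; have : L v by apply: WL.
  apply: (@closed_span_sub _ _ _ [set v | a v = 0]).
  + exact: kernel_subspace.
  + exact: kernel_closed.
  + by move=> w [V bV Vw]; apply: (a0 V).
- split; [exact: nest0| |].
    by move=> _ ->; exact: op_v0.
  move=> W0; apply: un0; apply: op_ext => v; rewrite op0.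
  by apply: W0; rewrite /range_of /= -opM uu.
Qed.


Section Atom.
Variables (u : A) (p : X) (g : X -> K).
Hypotheses (cu : comparable u) (at_u : atom_at u p g).

Lemma atom_admissible w : u w = w -> admissible w g.
Proof.
have [_ bg _ _ at_] := at_u; move=> uw; split=> // V NV.
by have [WV|[_ g0]] := at_ V NV; [left; apply: WV|right].
Qed.

Let up : u p = p. Proof. by have [] := at_u. Qed.
Let gp : g p = 1. Proof. by have [] := at_u. Qed.
Let gu v : g (u v) = g v. Proof. by have [_ _ ->] := at_u. Qed.
Let bg : bounded_functional g. Proof. by have [] := at_u. Qed.
Let uu v : u (u v) = u v. Proof. by rewrite -opM cu.1. Qed.
Let adm := atom_admissible.
Let e := rank_one p g.
Let eE v : e v = g v *: p. Proof. by rewrite rank_oneE//; exact: adm. Qed.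

Lemma atom_minimal_corner : minimal_corner scalar_op u e.
Proof.
split.
- exact: cu.1.
- by split; apply: op_ext => v; rewrite opM !eE ?op_scalev ?up ?gu.
- by apply: op_ext => v; rewrite opM !eE bfZ// gp mulr1.
- move=> x; exists (g (x p)); apply: op_ext => v.
  by rewrite !opM scalar_opE !eE op_scalev bfZ// scalerA mulrC.
- move=> b [ub bu] bm; apply: op_ext => v; rewrite -bu opM op0.
  set w := (u - e) v.
  have uw : u w = w by rewrite /w !opB !eE op_subv op_scalev up uu.
  have gw : g w = 0 by rewrite /w opB eE bfB// bfZ// gp gu mulr1 subrr.
  have rw v' : rank_one w g v' = g v' *: w by rewrite rank_oneE//; exact: adm.
  have : b * rank_one w g = 0.
    apply: bm; apply: op_ext => v'; rewrite opM.
    + by rewrite eE rw bfZ// gw mulr0 scale0r op0.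
    + by rewrite rw eE bfZ// gp mulr1 rw.
    + by rewrite rw op_scalev uw.
  by move/(congr1 (fun a : A => a p)); rewrite opM rw gp scale1r op0.
Qed.

(** Members strictly below the range of u are in the kernel of g. *)
Lemma atom_comparable : comparable (u - e).
Proof.
have rng v : (u - e) v = v -> u v = v /\ g v = 0.
  move=> h; have uv : u v = v.
    by rewrite -h opB eE op_subv op_scalev up uu.
  split=> //; move: h; rewrite opB eE uv => /eqP; rewrite -subr_eq0 addrAC subrr sub0r
    oppr_eq0.
  by rewrite scaler_eq0 => /orP[/eqP//|/eqP p0]; move: gp; rewrite p0 bf0// => /eqP;
    rewrite eq_sym oner_eq0.
split; first exact: mc_vv atom_minimal_corner.
move=> V NV; have [_ _ _ _ at_] := at_u; have [WV|[VW g0]] := at_ V NV.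
  by right=> v /rng[uv _]; apply: WV.
left=> v Vv; change ((u - e) v = v).
by rewrite opB eE g0// scale0r subr0; apply: VW.
Qed.

Lemma atom_center : trivial_center scalar_op u.
Proof.
move=> c [uc cuc] comm; exists (g (c p)); apply: op_ext => v.
rewrite -[in LHS]cuc !opM scalar_opE; set w := u v.
have uw : u w = w by rewrite /w uu.
have aw := adm uw.
have : c * rank_one w g = rank_one w g * c.
  apply: comm; split; apply: op_ext => v'; rewrite opM !rank_oneE ?op_scalev ?uw//.
  by rewrite gu.
by move/(congr1 (fun a : A => a p)); rewrite !opM !rank_oneE// gp scale1r.
Qed.

End Atom.


(** * Room between the members of the nest *)

Definition add_line V q : set X := [set v | exists t : K, V (v - t *: q)].

Lemma add_line_subspace V q : is_subspace V -> is_subspace (add_line V q).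
Proof.
move=> sV; split; first by exists 0; rewrite scale0r subr0; exact: sV.1.
move=> t v w [s Vs] [s' Vs']; exists (t * s + s').
have -> : t *: v + w - (t * s + s') *: q = t *: (v - s *: q) + (w - s' *: q).
  by rewrite scalerDl opprD addrACA scalerBr scalerA.
exact: sV.2.
Qed.

Lemma sub_add_line V q : V `<=` add_line V q.
Proof. by move=> v Vv; exists 0; rewrite scale0r subr0. Qed.

Lemma add_line_mono U V q : U `<=` V -> add_line U q `<=` add_line V q.
Proof. by move=> UV v [t Ut]; exists t; apply: UV. Qed.

Lemma add_line_min U V q : is_subspace V -> U `<=` V -> V q -> add_line U q `<=` V.
Proof.
move=> sV UV Vq v [t Ut]; rewrite -(subrK (t *: q) v).
by apply: subspaceD => //; [apply: UV|apply: subspaceZ].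
Qed.

Lemma add_line_exchange U V q v : is_subspace V -> U `<=` V ->
  add_line U q v -> V v -> ~ U v -> V q.
Proof.
move=> sV UV [t Ut] Vv nUv; have [t0|t0] := eqVneq t 0.
  by case: nUv; move: Ut; rewrite t0 scale0r subr0.
have -> : q = t^-1 *: (v - (v - t *: q)) by rewrite subKr scalerA mulVf// scale1r.
by apply: subspaceZ => //; apply: subspaceB => //; apply: UV.
Qed.

(** With f vanishing on V and f q = 1, V + K q is the preimage of V under
    v |-> v - f(v) q. *)
Lemma add_line_closed V q : is_subspace V -> closed V -> closed (add_line V q).
Proof.
move=> sV clV; have [Vq|nVq] := pselect (V q).
  suff -> : add_line V q = V by [].
  by apply/seteqP; split; [exact: add_line_min|exact: sub_add_line].
have [f [bf fV fq]] := sepX sV clV nVq.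
pose T : bounded_op X := op_one X - BoundedOp (rank_one_bounded q bf).
have TE v : T v = v - f v *: q by [].
suff -> : add_line V q = [set v | V (T v)] by exact: bounded_op_closed_preim.
apply/seteqP; split=> v; last by change (V (T v) -> add_line V q v); rewrite TE;
  exists (f v).
move=> [t Vt]; change (V (T v)); rewrite TE; suff -> : f v = t by [].
by apply/eqP; rewrite -subr_eq0 -[t]mulr1 -fq -bfZ// -bfB// fV.
Qed.

Lemma not_sub_ex U V : ~ V `<=` U -> exists v, V v /\ ~ U v.
Proof.
move=> h; apply: contrapT => nex; apply: h => v Vv; apply: contrapT => nUv.
by apply: nex; exists v.
Qed.

(** If U + K q contained V2, it would contain V1, so q would be in V1, and V2 too. *)
Lemma escape_line U V1 V2 q : is_subspace V1 -> U `<=` V1 -> ~ V1 `<=` U ->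
  V1 `<=` V2 -> ~ V2 `<=` V1 -> ~ V2 `<=` add_line U q.
Proof.
move=> sV1 UV1 /not_sub_ex[v1 [Vv1 nUv1]] V12 nV21 V2U; apply: nV21.
have V1q := add_line_exchange sV1 UV1 (V2U _ (V12 _ Vv1)) Vv1 nUv1.
by move=> v /V2U; apply: add_line_min.
Qed.

Lemma escape_plane U V1 V2 V3 q w : is_subspace U -> is_subspace V1 -> is_subspace V2 ->
  U `<=` V1 -> ~ V1 `<=` U -> V1 `<=` V2 -> ~ V2 `<=` V1 -> V2 `<=` V3 -> ~ V3 `<=` V2 ->
  ~ V3 `<=` add_line (add_line U q) w.
Proof.
move=> sU sV1 sV2 UV1 /not_sub_ex[v1 [Vv1 nUv1]] V12 nV21 V23 nV32 V3U.
have Uv1 := V3U _ (V23 _ (V12 _ Vv1)).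
have [Sv1|nSv1] := pselect (add_line U q v1).
  have V1q := add_line_exchange sV1 UV1 Sv1 Vv1 nUv1.
  apply: (@escape_line V1 V2 V3 w) => //.
  by apply: (subset_trans V3U); apply: add_line_mono; apply: add_line_min.
apply: (@escape_line V1 V2 V3 q) => //; apply: (subset_trans V3U).
have sL := add_line_subspace q sV1; have UL := @add_line_mono _ _ q UV1.
apply: add_line_min => //.
exact: (add_line_exchange sL UL Uv1 (@sub_add_line V1 q v1 Vv1) nSv1).
Qed.


(** * Limit corners: centers and centroids *)

Section Limit.
Variable u : A.
Hypotheses (cu : comparable u) (lu : limit_at u).

Lemma below_nest V : below u V -> nst V. Proof. by case. Qed.
Lemma below_range V v : below u V -> V v -> u v = v. Proof. by case=> _ h _; apply: h. Qed.
Lemma below_sub V : below u V -> is_subspace V. Proof. by move/below_nest/nest_subspace.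
  Qed.
Lemma below_total U V : below u U -> below u V -> U `<=` V \/ V `<=` U.
Proof. by move=> [NU _ _] [NV _ _]; apply: nest_total. Qed.

Lemma below_join U V : below u U -> below u V ->
  exists Z, [/\ below u Z, U `<=` Z & V `<=` Z].
Proof. by move=> bU bV; have [UV|VU] := below_total bU bV; [exists V; split|exists U;
  split]. Qed.

(** A chain of n strict steps from U to V.  Three steps leave room for a vector of V that is
    independent modulo U of two given vectors ([gap_escape]). *)
Fixpoint gap n U V : Prop := if n is m.+1
  then exists U', [/\ below u U, U `<=` U', ~ U' `<=` U & gap m U' V]
  else [/\ below u U, below u V & U `<=` V].

Lemma gap0 n U V : gap n U V -> [/\ below u U, below u V & U `<=` V].
Proof.
elim: n U => // n IH U [U' [bU UU' _ /IH[_ bV U'V]]].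
by split=> //; apply: subset_trans U'V.
Qed.

Lemma gap_exists n U : below u U -> exists V, gap n U V.
Proof.
have [up _ _] := lu; elim: n U => [U bU|n IH U bU]; first by exists U; split.
have [U' [bU' UU' nU'U]] := up _ bU; have [V gV] := IH _ bU'.
by exists V, U'.
Qed.

Lemma gap_extend n U V V' : gap n U V -> V `<=` V' -> below u V' -> gap n U V'.
Proof.
move=> + VV' bV'; elim: n U => [U [bU _ UV]|n IH U [U' [bU UU' nU'U /IH gV]]].
  by split=> //; apply: subset_trans VV'.
by exists U'.
Qed.

Lemma gap_split m n U V : gap (m + n) U V -> exists Z, gap m U Z /\ gap n Z V.
Proof.
elim: m U => [U gU|m IH U [U' [bU UU' nU'U /IH[Z [g1 g2]]]]].
  by exists U; have [bU _ _] := gap0 gU; split; first by split.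
by exists Z; split=> //; exists U'.
Qed.

Lemma gap_escape U V q w : gap 3 U V ->
  exists v, V v /\ ~ add_line (add_line U q) w v.
Proof.
move=> [V1 [bU UV1 nV1U [V2 [bV1 V12 nV21 [V3 [bV2 V23 nV32 [bV3 _ V3V]]]]]]].
have := escape_plane (q := q) (w := w) (below_sub bU) (below_sub bV1) (below_sub bV2)
  UV1 nV1U V12 nV21 V23 nV32.
by move=> /not_sub_ex[v [V3v nv]]; exists v; split=> //; apply: V3V.
Qed.

(** The dual of the range of u, embedded into that of X by composition with u *)
Definition dual f := bounded_functional f /\ forall v, f (u v) = f v.

Let uu v : u (u v) = u v. Proof. by rewrite -opM cu.1. Qed.

Lemma separate_plane U q w v : below u U -> u q = q -> u w = w -> u v = v ->
  ~ add_line (add_line U q) w v ->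
  exists f, [/\ dual f, forall z, U z -> f z = 0, f q = 0, f w = 0 & f v = 1].
Proof.
move=> bU uq uw uv nv; have sU := below_sub bU.
have sU1 := add_line_subspace q sU.
have [f [bf f0 fv]] := sepX (add_line_subspace w sU1)
  (add_line_closed (q := w) sU1 (add_line_closed (q := q) sU (nest_closed (below_nest
    bU)))) nv.
exists (fun z => f (u z)); split.
- by split; [exact: bounded_functional_comp|move=> z; rewrite uu].
- by move=> z Uz; rewrite (below_range bU Uz) f0//; do 2! apply: sub_add_line.
- rewrite uq f0//; apply: sub_add_line; exists 1; rewrite scale1r subrr; exact: sU.1.
- rewrite uw f0//; exists 1; rewrite scale1r subrr; exact: sU1.1.
- by rewrite uv.
Qed.

(** The rank-one operator of p and f has the room of n steps between its range and its
    kernel. *)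
Definition far n p f := dual f /\
  exists U V, [/\ gap n U V, U p & forall v, V v -> f v = 0].

Lemma dualD f g : dual f -> dual g -> dual (fun v => f v + g v).
Proof.
by move=> [bf fu] [bg gu]; split; [exact: bounded_functionalD|move=> v; rewrite fu gu].
Qed.
Lemma dualZ f (t : K) : dual f -> dual (fun v => t * f v).
Proof. by move=> [bf fu]; split; [exact: bounded_functionalZ|move=> v; rewrite fu]. Qed.

Lemma far_weaken n p f : far n p f -> far 0 p f.
Proof. by move=> [df [U [V [/gap0 g Up f0]]]]; split=> //; exists U, V. Qed.

Lemma far_range n p f : far n p f -> u p = p.
Proof. by move=> [_ [U [V [/gap0[bU _ _] Up _]]]]; apply: below_range Up. Qed.

Lemma far_dual n p f : far n p f -> dual f. Proof. by case. Qed.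

Lemma far_zero n p f : far n p f -> f p = 0.
Proof. by move=> [_ [U [V [/gap0[_ _ UV] Up f0]]]]; apply/f0/UV. Qed.

Lemma far_admissible n p f : far n p f -> admissible p f.
Proof.
move=> [[bf _] [U [V [/gap0[bU bV UV] Up f0]]]]; split=> // Z NZ.
have [ZV|VZ] := nest_total NZ (below_nest bV); first by right=> v Zv; apply/f0/ZV.
by left; apply/VZ/UV.
Qed.

Lemma far_op n p f x : far n p f -> far n (x p) f.
Proof.
move=> [df [U [V [gV Up f0]]]]; split=> //; exists U, V; split=> //.
by have [bU _ _] := gap0 gV; apply: nest_sub Up; exact: below_nest.
Qed.

Lemma far_comp n p f x : corner u x -> far n p f -> far n p (fun v => f (x v)).
Proof.
move=> [ux xu] [[bf fu] [U [V [gV Up f0]]]]; split.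
  split; first exact: bounded_functional_comp.
  by move=> v; rewrite -opM xu.
exists U, V; split=> // v Vv; apply: f0; have [_ bV _] := gap0 gV.
by apply: nest_sub Vv; exact: below_nest.
Qed.

Lemma far_corner n p f : far n p f -> corner u (rank_one p f).
Proof.
move=> fp; have ad := far_admissible fp; have [[_ fu] _] := fp.
by split; apply: op_ext => v; rewrite opM !rank_oneE// ?op_scalev ?(far_range fp) ?fu.
Qed.

Lemma nonzero_below : exists U p, [/\ below u U, U p & p != 0].
Proof.
have [up _ b0] := lu; have [U [bU _ /not_sub_ex[p [Up p0]]]] := up _ b0.
by exists U, p; split=> //; apply/eqP.
Qed.

Definition inner v := exists V, below u V /\ V v.

Lemma inner_join q w : inner q -> inner w -> exists V, [/\ below u V, V q & V w].
Proof.
move=> [V [bV Vq]] [W [bW Ww]]; have [Z [bZ VZ WZ]] := below_join bV bW.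
by exists Z; split=> //; [apply: VZ|apply: WZ].
Qed.

Lemma far_inner n p f : far n p f -> inner p.
Proof. by move=> [_ [U [V [/gap0[bU _ _] Up _]]]]; exists U. Qed.

(** The vector v at which f is 1 is found in a member strictly below the range of u, so
    that it can itself be used in far pairs. *)
Lemma far_functional n U : below u U ->
  exists f v, [/\ dual f, inner v, f v = 1 & forall p, U p -> far n p f].
Proof.
move=> bU; have [V gV] := gap_exists n bU; have [_ bV _] := gap0 gV.
have [Z gZ] := gap_exists 3 bV; have [v [Zv nv]] := gap_escape 0 0 gZ.
have [_ bZ _] := gap0 gZ; have uv := below_range bZ Zv.
have [f [df f0 _ _ fv]] := separate_plane bV (op_v0 u) (op_v0 u) uv nv.
by exists f, v; split=> //; [exists Z|move=> p Up; split=> //; exists U, V].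
Qed.

Lemma dual_support p f : p != 0 -> admissible p f -> dual f -> (exists v, f v <> 0) ->
  exists w, inner w /\ f w <> 0.
Proof.
move=> p0 af [bf fu] [v fv]; apply: contrapT => h; have [_ dense _] := lu.
have : rank_one p f (u v) = 0.
  apply: dense; last exact: uu.
  move=> V w bV Vw; rewrite rank_oneE//; apply/eqP; rewrite scaler_eq0; apply/orP; left.
  by apply/eqP; apply: contrapT => fw; apply: h; exists w; split=> //; exists V.
by rewrite rank_oneE// fu => /eqP; rewrite scaler_eq0 (negPf p0) orbF => /eqP.
Qed.

(** c (p (x) f) = (p (x) f) c makes p an eigenvector whose eigenvalue f(c v), for f v = 1,
    does not depend on p in a given member of the nest.  The members form a chain, so
    there is only one eigenvalue, and density extends it to the range of u. *)
Lemma far_commutant n c : corner u c ->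
  (forall p f, far n p f -> c * rank_one p f = rank_one p f * c) ->
  exists t, c = scalar_op t * u.
Proof.
move=> [uc cuc] comm.
have eig U : below u U -> exists t : K, forall p, U p -> c p = t *: p.
  move=> bU; have [f [v [df uv fv fp]]] := far_functional n bU.
  exists (f (c v)) => p Up; have ad := far_admissible (fp p Up).
  have := comm p f (fp p Up) => /(congr1 (fun a : A => a v)).
  by rewrite !opM !rank_oneE// fv scale1r.
have [U0 [p0 [bU0 U0p0 p00]]] := nonzero_below.
have [t ct] := eig _ bU0; exists t; apply/eqP; rewrite -subr_eq0; apply/eqP.
have [_ dense _] := lu; apply: op_ext => v; rewrite op0.
have : (c - scalar_op t * u) (u v) = 0.
  apply: dense; last exact: uu.
  move=> V w bV Vw; rewrite opB opM scalar_opE (below_range bV Vw).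
  have [Z [bZ VZ UZ]] := below_join bV bU0; have [t' ct'] := eig _ bZ.
  have /eqP : t *: p0 = t' *: p0 by rewrite -ct// -ct'//; exact: UZ.
  rewrite -subr_eq0 -scalerBl scaler_eq0 (negPf p00) orbF subr_eq0 => /eqP->.
  by rewrite ct' ?subrr//; apply: VZ.
by rewrite !opB !opM !scalar_opE uu -opM cuc.
Qed.


Lemma eigenvalue_eq (t t' t'' : K) (a b : A) :
  t *: a + t' *: b = t'' *: (a + b) -> a <> 0 -> (forall s : K, b <> s *: a) -> t = t'.
Proof.
move=> E a0 nb; have h : (t - t'') *: a = (t'' - t') *: b.
  apply/eqP; rewrite -subr_eq0 !scalerBl opprB addrACA.
  rewrite (_ : _ + _ = (t *: a + t' *: b) - t'' *: (a + b)); last first.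
    by rewrite scalerDr opprD; ncring.
  by rewrite E subrr.
have [e|ne] := eqVneq t'' t'.
  move/eqP: h; rewrite e subrr scale0r scaler_eq0 subr_eq0 => /orP[/eqP//|/eqP].
  by move/a0.
case: (nb ((t'' - t')^-1 * (t - t''))).
by rewrite -scalerA h scalerA mulVf ?scale1r// subr_eq0.
Qed.

Definition vanishing (Up : set (set X)) f :=
  dual f /\ exists V, Up V /\ forall v, V v -> f v = 0.

Definition upper_family (Up : set (set X)) := [/\ exists V, Up V,
  forall V, Up V -> below u V & forall V V', Up V -> V `<=` V' -> below u V' -> Up V'].

Lemma vanishingD Up f g : upper_family Up -> vanishing Up f -> vanishing Up g ->
  vanishing Up (fun v => f v + g v).
Proof.
move=> [_ bel _] [df [V [UV f0]]] [dg [V' [UV' g0]]]; split; first exact: dualD.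
have [VV'|V'V] := below_total (bel _ UV) (bel _ UV'); [exists V|exists V']; split=> // v Vv.
  by rewrite f0// g0 ?addr0//; apply: VV'.
by rewrite g0// f0 ?addr0//; apply: V'V.
Qed.

Lemma vanishingZ Up f (t : K) : vanishing Up f -> vanishing Up (fun v => t * f v).
Proof.
move=> [df [V [UV f0]]]; split; first exact: dualZ.
by exists V; split=> // v Vv; rewrite f0// mulr0.
Qed.

Lemma vanishing_nonzero Up V : upper_family Up -> below u V ->
  exists f v, [/\ vanishing Up f, forall w, V w -> f w = 0, inner v & f v = 1].
Proof.
move=> [[V' UV'] bel up] bV; have [Z [bZ VZ V'Z]] := below_join bV (bel _ UV').
have [f [v [df uv fv fp]]] := far_functional 0 bZ.
exists f, v; split=> //; last by move=> w Vw; apply: far_zero (fp w (VZ _ Vw)).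
split=> //; exists Z; split; first exact: up UV' V'Z bZ.
by move=> w Zw; apply: far_zero (fp w Zw).
Qed.

(** The eigenvalues at independent f and g agree because the one at f + g exists.  If f and
    g are dependent, both are compared with a functional k that kills members on which f
    and g are not zero. *)
Lemma functional_eigenvalue_constant p Up (phi : (X -> K) -> A) : p != 0 -> upper_family
  Up ->
  (forall f, vanishing Up f -> admissible p f) ->
  (forall f g, vanishing Up f -> vanishing Up g ->
    phi (fun v => f v + g v) = phi f + phi g) ->
  (forall f, vanishing Up f -> exists t, phi f = t *: rank_one p f) ->
  exists t, forall f, vanishing Up f -> phi f = t *: rank_one p f.
Proof.
move=> p0 uUp adm phiD eig; have [_ _ b0] := lu.
have supp f : vanishing Up f -> (exists v, f v <> 0) ->
    exists V w, [/\ below u V, V w & f w <> 0].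
  move=> vf nf; have [w [[V [bV Vw]] fw]] := dual_support p0 (adm f vf) vf.1 nf.
  by exists V, w.
have same f g tf tg : vanishing Up f -> vanishing Up g ->
    (exists v, f v <> 0) -> (exists v, g v <> 0) ->
    phi f = tf *: rank_one p f -> phi g = tg *: rank_one p g -> tf = tg.
  move=> vf vg nf ng Ef Eg.
  have [V1 [w1 [bV1 Vw1 fw1]]] := supp f vf nf; have [V2 [w2 [bV2 Vw2 gw2]]] := supp g vg
    ng.
  have [Z [bZ V1Z V2Z]] := below_join bV1 bV2.
  have [k [v [vk k0 uv kv]]] := vanishing_nonzero uUp bZ.
  have [tk Ek] := eig k vk.
  have indep f' w tf' : vanishing Up f' -> Z w -> f' w <> 0 ->
      phi f' = tf' *: rank_one p f' -> tf' = tk.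
    move=> vf' Zw f'w Ef'; have [t'' E] := eig _ (vanishingD uUp vf' vk).
    have [a1 a2] := (adm _ vf', adm _ vk).
    apply: (@eigenvalue_eq tf' tk t'' (rank_one p f') (rank_one p k)).
    - by rewrite -Ef' -Ek -phiD// E rank_oneDr.
    - move/(congr1 (fun a : A => a w)); rewrite op0 rank_oneE// => /eqP.
      by rewrite scaler_eq0 (negPf p0) orbF => /eqP.
    - move=> s Es; have := congr1 (fun a : A => a w) Es.
      rewrite opZ !rank_oneE// k0// scale0r scalerA => /esym/eqP.
      rewrite scaler_eq0 (negPf p0) orbF mulf_eq0 => /orP[/eqP s0|/eqP//].
      have := congr1 (fun a : A => a v) Es; rewrite s0 scale0r op0 rank_oneE// kv scale1r.
      by move/eqP; rewrite (negPf p0).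
  rewrite (indep f w1 tf vf (V1Z _ Vw1) fw1 Ef).
  by rewrite (indep g w2 tg vg (V2Z _ Vw2) gw2 Eg).
have [f0 [v0 [vf0 _ _ f0v]]] := vanishing_nonzero uUp b0.
have nf0 : exists v, f0 v <> 0 by exists v0; rewrite f0v; apply/eqP; rewrite oner_eq0.
have [t0 E0] := eig _ vf0; exists t0 => f vf; have [t E] := eig _ vf.
have [nf|zf] := pselect (exists v, f v <> 0).
  by rewrite E (same f f0 t t0).
rewrite E (rank_one_zero _ (adm _ vf)) ?scaler0// => v.
by apply: contrapT => fv; apply: zf; exists v.
Qed.

Lemma far_vanishing n p f :
  far n p f <-> vanishing [set V | exists U, gap n U V /\ U p] f.
Proof.
split=> -[df]; first by move=> [U [V [gV Up f0]]]; split=> //; exists V; split=> //;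
  exists U.
by move=> [V [[U [gV Up]] f0]]; split=> //; exists U, V.
Qed.

Lemma far_upper_family n U p : below u U -> U p ->
  upper_family [set V | exists U, gap n U V /\ U p].
Proof.
move=> bU Up; split; first by have [V gV] := gap_exists n bU; exists V, U.
  by move=> V [U' [/gap0[_ bV _] _]].
by move=> V V' [U' [gV U'p]] VV' bV'; exists U'; split=> //; apply: gap_extend VV' bV'.
Qed.

Lemma farDl n p q f : far n p f -> far n q f -> far n (p + q) f.
Proof.
move=> [df [U [V [gV Up f0]]]] [_ [U' [V' [gV' Uq f0']]]]; split=> //.
have [[bU bV _] [bU' bV' _]] := (gap0 gV, gap0 gV').
have [UU'|U'U] := below_total bU bU'; [exists U', V'|exists U, V]; split=> //.
  by apply: subspaceD => //; [exact: below_sub|apply: UU'].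
by apply: subspaceD => //; [exact: below_sub|apply: U'U].
Qed.

(** For fixed p this is [functional_eigenvalue_constant].  Independent p and p' are
    compared through p + p' and a common f; if p' = s p, the scalar is moved to f. *)
Lemma far_eigenvalue_constant n (T : A -> A) :
  (forall a b, corner u a -> corner u b -> T (a + b) = T a + T b) ->
  (forall p f, far n p f -> exists t, T (rank_one p f) = t *: rank_one p f) ->
  exists t, forall p f, far n p f -> T (rank_one p f) = t *: rank_one p f.
Proof.
move=> TD eig.
have fixp p U : p != 0 -> below u U -> U p ->
    exists t, forall f, far n p f -> T (rank_one p f) = t *: rank_one p f.
  move=> p0 bU Up.
  have [|f g|f|t tE] := @functional_eigenvalue_constant p _ (fun f => T (rank_one p f))
    p0 (far_upper_family n bU Up).
  - by move=> f /far_vanishing; apply: far_admissible.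
  - move=> /far_vanishing vf /far_vanishing vg.
    by rewrite (rank_oneDr (far_admissible vf) (far_admissible vg)) (TD _ _ (far_corner
      vf) (far_corner vg)).
  - by move=> /far_vanishing; apply: eig.
  - by exists t => f /far_vanishing; apply: tE.
have [U0 [p0 [bU0 U0p0 p00]]] := nonzero_below.
have [t0 E0] := fixp _ _ p00 bU0 U0p0.
exists t0 => p f pf; have ad := far_admissible pf.
have T0 := centroid0 TD.
have [p_eq0|pn0] := eqVneq p 0.
  suff -> : rank_one p f = 0 by rewrite T0 scaler0.
  by apply: op_ext => v; rewrite rank_oneE// p_eq0 scaler0.
have [_ [U [V [gV Up _]]]] := pf; have [bU _ _] := gap0 gV.
have [t Et] := fixp p U pn0 bU Up.
suff -> : t0 = t by apply: Et.
have [Z [bZ UZ U0Z]] := below_join bU bU0.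
have [g [v [dg uv gv gp]]] := far_functional n bZ.
have [gp0 gpp] := (gp _ (U0Z _ U0p0), gp _ (UZ _ Up)).
have [a0 a1] := (far_admissible gp0, far_admissible gpp).
have r0 : rank_one p0 g <> 0.
  move/(congr1 (fun a : A => a v)); rewrite rank_oneE// op0 gv scale1r => /eqP.
  by rewrite (negPf p00).
have [[s ps]|indep] := pselect (exists s : K, p = s *: p0).
  have s0 : s != 0 by apply: contraNneq pn0 => s0; rewrite ps s0 scale0r.
  have gs : far n p0 (fun v => s * g v).
    by apply/far_vanishing; apply: vanishingZ; apply/far_vanishing.
  have h : rank_one p g = rank_one p0 (fun v => s * g v).
    by rewrite ps rank_oneZl// rank_oneZr.
  have := Et _ gpp; rewrite {1}h E0// -h => /eqP; rewrite -subr_eq0 -scalerBl.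
  rewrite scaler_eq0 subr_eq0 => /orP[/eqP//|/eqP]; rewrite ps rank_oneZl// => /eqP.
  by rewrite scaler_eq0 (negPf s0) => /eqP.
have [t'' E''] := eig _ _ (farDl gp0 gpp).
apply: (eigenvalue_eq (t'' := t'') (a := rank_one p0 g) (b := rank_one p g)) => //.
  by rewrite -E0// -Et// -(TD _ _ (far_corner gp0) (far_corner gpp)) -rank_oneDl.
move=> s Es; apply: indep; exists s; have := congr1 (fun a : A => a v) Es.
by rewrite opZ !rank_oneE// gv !scale1r.
Qed.

Lemma multiple_of_rank_one (a : A) p f : admissible p f ->
  (forall w, exists t : K, a w = t *: p) -> (forall w, f w = 0 -> a w = 0) ->
  exists t, a = t *: rank_one p f.
Proof.
move=> ad ap af; have [bf _] := ad.
have [[w0 fw0]|zf] := pselect (exists v, f v != 0); last first.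
  exists 0; rewrite scale0r; apply: op_ext => v; rewrite op0; apply: af.
  by apply: contrapT => fv; apply: zf; exists v; apply/eqP.
have [t tE] := ap w0; exists (t / f w0); apply: op_ext => z.
rewrite opZ rank_oneE// scalerA.
have /af : f (z - (f z / f w0) *: w0) = 0 by rewrite bfB// bfZ// mulfVK// subrr.
rewrite op_subv op_scalev tE scalerA => /eqP; rewrite subr_eq0 => /eqP->.
by congr (_ *: p); ring.
Qed.

Lemma limit_center : trivial_center scalar_op u.
Proof.
move=> c uc comm; apply: (far_commutant (n := 0) uc) => p f pf.
exact/comm/(far_corner pf).
Qed.

(** For r = p (x) f = [p (x) k, v (x) f] with k v = 1, T r = [p (x) k, T (v (x) f)] maps
    each w with k w = 0 into the line of p, and T r = [T (p (x) k), v (x) f] maps the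
    kernel of f into the line of v.  As k can be chosen to kill any given w, T r is a
    multiple of r. *)
Lemma limit_centroid : trivial_centroid scalar_op u.
Proof.
move=> T Tu TD TL; have TR := centroid_right TD TL.
have [p f pf|t Et] := @far_eigenvalue_constant 3 T TD.
  have ad := far_admissible pf; have up := far_range pf.
  have [[bf fu] [U [V [gV Up f0]]]] := pf.
  have [bU bV UV] := gap0 gV.
  have [T1 T2] : (forall w, u w = w -> exists t : K, T (rank_one p f) w = t *: p) /\
      (forall w, u w = w -> f w = 0 -> T (rank_one p f) w = 0).
    have key w : u w = w -> exists v (t : K), [/\ ~ U v,
        T (rank_one p f) w = t *: p &
        (f w = 0 -> exists s : K, T (rank_one p f) w = s *: v)].
      move=> uw; have [v [Vv nv]] := gap_escape 0 w gV.
      have uv := below_range bV Vv.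
      have [k [[bk ku] k0 _ kw kv]] := separate_plane bU (op_v0 u) uw uv nv.
      have apk : admissible p k.
        split=> // Z NZ; have [ZU|UZ] := nest_total NZ (below_nest bU).
          by right=> z Zz; apply/k0/ZU.
        by left; apply: UZ.
      have avf : admissible v f.
        split=> // Z NZ; have [ZV|VZ] := nest_total NZ (below_nest bV).
          by right=> z Zz; apply/f0/ZV.
        by left; apply: VZ.
      have cpk : corner u (rank_one p k).
        by split; apply: op_ext => z; rewrite opM !rank_oneE// ?op_scalev ?up ?ku.
      have cvf : corner u (rank_one v f).
        by split; apply: op_ext => z; rewrite opM !rank_oneE// ?op_scalev ?uv ?fu.
      have fp : f p = 0 by apply/f0/UV.
      have E : rank_one p f = [!rank_one p k, rank_one v f].
        apply: op_ext => z; rewrite /lie_bracket opB !opM !rank_oneE// !(bfZ _ _ bk, bfZ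
          _ _ bf).
        by rewrite kv fp !mulr0 scale0r subr0 mulr1.
      exists v, (k (T (rank_one v f) w)); split.
      - by move=> Uv; apply: nv; do 2! apply: sub_add_line.
      - rewrite E TR// /lie_bracket opB !opM !rank_oneE// kw scale0r op_v0 subr0 //.
      - move=> fw; exists (- f (T (rank_one p k) w)).
        by rewrite E TL// /lie_bracket opB !opM !rank_oneE// fw scale0r op_v0 sub0r scaleNr.
    split=> w uw; first by have [v [t [_ E _]]] := key w uw; exists t.
    move=> fw; have [v [t [nUv E /(_ fw)[s Es]]]] := key w uw.
    have [s0|s0] := eqVneq s 0; first by rewrite Es s0 scale0r.
    case: nUv; have -> : v = (s^-1 * t) *: p by rewrite -scalerA -E Es scalerA mulVf//
      scale1r.
    by apply: subspaceZ Up; apply: below_sub.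
  have [_ Tru] := Tu _ (far_corner pf); apply: (multiple_of_rank_one ad) => w.
    by have [t Et] := T1 _ (uu w); exists t; rewrite -Et -opM Tru.
  by move=> fw; rewrite -Tru opM T2// fu.
have comm x : corner u x -> exists m, T x - t *: x = scalar_op m * u.
  move=> ux; have uTx := Tu x ux.
  have cD : corner u (T x - t *: x) by rewrite -scalar_opM; apply: cornerB => //;
    apply: (cornerZ scalar_opC).
  apply: (far_commutant (n := 3) cD) => p f pf; have cpf := far_corner pf.
  have := TL x _ ux cpf; rewrite TR// Et// => h.
  apply/eqP; rewrite -subr_eq0 -scalar_opM -[X in X == _]/([!_, _]).
  by rewrite (lieBl (T x)) -h -scalar_opM (lieZl scalar_opC) lieC (lieZl scalar_opC) lieC
    -mulrN opprK subrr.
have [m mE] : exists m : A -> K, forall x, corner u x -> T x - t *: x = scalar_op (m x) * u.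
  have tot x : exists m, corner u x -> T x - t *: x = scalar_op m * u.
    have [ux|] := pselect (corner u x); last by exists 0.
    by have [m E] := comm x ux; exists m.
  by have [m mE] := choice tot; exists m.
exists t, m => x ux; rewrite scalar_opM -(mE x ux) addrC subrK //.
Qed.


Lemma rank_one_mul0 p f q g : admissible p f -> admissible q g -> f q = 0 ->
  rank_one p f * rank_one q g = 0.
Proof.
move=> ap aq fq; apply: op_ext => v.
by rewrite opM !rank_oneE// bfZ ?fq ?mulr0 ?scale0r//; exact: ap.1.
Qed.

Lemma rank_one_mulE p f q g : admissible p f -> admissible q g -> admissible p g ->
  rank_one p f * rank_one q g = f q *: rank_one p g.
Proof.
move=> ap aq apg; apply: op_ext => v.
by rewrite opM opZ !rank_oneE// bfZ ?scalerA 1?mulrC//; exact: ap.1.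
Qed.

Lemma admissible_between U p f : below u U -> U p -> bounded_functional f ->
  (forall v, U v -> f v = 0) -> admissible p f.
Proof.
move=> bU Up bf f0; split=> // Z NZ; have [ZU|UZ] := nest_total NZ (below_nest bU).
  by right=> z Zz; apply/f0/ZU.
by left; apply: UZ.
Qed.

Lemma far_scaler n p f (t : K) : far n p f -> far n p (fun v => t * f v).
Proof. by move=> /far_vanishing h; apply/far_vanishing/vanishingZ. Qed.

Lemma far_scalel n p f (t : K) : far n p f -> far n (t *: p) f.
Proof.
move=> [df [U [V [gV Up f0]]]]; split=> //; exists U, V; split=> //.
by apply: subspaceZ => //; apply: below_sub; case: (gap0 gV).
Qed.

(** * Limit corners: equivariant products *)

Section Whole.
Hypothesis u1 : u = 1.
Let C1 x : corner u x. Proof. by rewrite u1; split; rewrite ?mul1r ?mulr1. Qed.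
Let rng v : u v = v. Proof. by rewrite u1. Qed.
Variable B : A -> A -> A.
Hypothesis eB : equivariant_product B.

(** Writing p (x) k as [p (x) g, v (x) k], where g q = g w = 0, shows that the value at w
    is in the line of p.  Writing q (x) f as [q (x) g, v (x) f], where k v = 0 and v is
    not a multiple of p, shows that the value is in the line of v when f w = 0. *)
Lemma product_disjoint q f p k : far 3 q f -> far 3 p k -> far 0 p f ->
  exists t, B (rank_one q f) (rank_one p k) = t *: rank_one p f.
Proof.
move=> qf pk pf; have [aqf apk apf] := And3 (far_admissible qf) (far_admissible pk)
  (far_admissible pf).
have [[[bf fu] [U [V [gV Uq f0]]]] [[bk ku] [U' [V' [gV' Up k0]]]]] := (qf, pk).
have [[bU bV UV] [bU' bV' UV']] := (gap0 gV, gap0 gV').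
have line w : exists t : K, B (rank_one q f) (rank_one p k) w = t *: p.
  have [v [V'v nv]] := gap_escape q w gV'.
  have [g [[bg gu] g0 gq gw gv]] := separate_plane bU' (rng q) (rng w) (rng v) nv.
  have apg := admissible_between bU' Up bg g0.
  have avk := admissible_between bV' V'v bk k0.
  exists (g (B (rank_one q f) (rank_one v k) w)).
  have E : [!rank_one v k, rank_one p g] = - rank_one p k.
    rewrite /lie_bracket rank_one_mul0 ?(far_zero pk)// sub0r.
    by rewrite rank_one_mulE// gv scale1r.
  have := ep_lie eB (rank_one q f) (rank_one v k) (rank_one p g).
  rewrite E (ep_oppr eB) {2}/lie_bracket rank_one_mul0 ?(far_zero pf)//.
  rewrite rank_one_mul0 ?gq// subrr (ep_0 eB) sub0r => /eqP.
  rewrite eq_sym eqr_oppLR => /eqP ->.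
  by rewrite opN /lie_bracket opB !opM !rank_oneE// gw scale0r op_v0 sub0r opprK.
apply: multiple_of_rank_one => // w fw.
have [v [Vv nv kv]] : exists v, [/\ V v, ~ add_line U p v & k v = 0].
  have [a [Va na]] := gap_escape p 0 gV.
  have {}na : ~ add_line U p a by move=> h; apply: na; apply: sub_add_line.
  have [ka|ka] := eqVneq (k a) 0; first by exists a.
  have [b [Vb nb]] := gap_escape p a gV.
  exists (b - (k b / k a) *: a); split.
  - by apply: subspaceB; [exact: below_sub|exact: Vb|apply: subspaceZ => //;
    exact: below_sub].
  - by move=> h; apply: nb; exists (k b / k a).
  - by rewrite bfB// bfZ// mulfVK// subrr.
have nv0 : ~ add_line (add_line U p) 0 v.
  by move=> [t]; rewrite scaler0 subr0.
have [g [[bg gu] g0 _ _ gv]] := separate_plane bU (rng p) (rng 0) (rng v) nv0.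
have aqg := admissible_between bU Uq bg g0.
have avf := admissible_between bV Vv bf f0.
have E : [!rank_one q g, rank_one v f] = rank_one q f.
  rewrite /lie_bracket (@rank_one_mul0 v f q g) ?(far_zero qf)// subr0.
  by rewrite rank_one_mulE// gv scale1r.
have := ep_lie eB (rank_one q g) (rank_one p k) (rank_one v f).
rewrite E {2}/lie_bracket rank_one_mul0// rank_one_mul0 ?(far_zero pf)//.
rewrite subrr (ep_0r eB) addr0 => h.
have [t Et] := line w; set D := B (rank_one q g) (rank_one p k) in h.
have Es : B (rank_one q f) (rank_one p k) w = - f (D w) *: v.
  by rewrite -h /lie_bracket opB !opM !rank_oneE// fw scale0r op_v0 sub0r scaleNr.
have [s0|s0] := eqVneq (f (D w)) 0; first by rewrite Es s0 oppr0 scale0r.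
case: nv; exists ((- f (D w))^-1 * t).
rewrite -scalerA -Et Es scalerA mulVf ?oppr_eq0// scale1r subrr.
exact: (below_sub bU).1.
Qed.

(** For fixed p and k, om is the value at q of a functional that turns out to be a
    multiple of k. *)
Definition product_value p k q (om : K) := forall f, far 3 q f -> far 0 p f ->
  B (rank_one q f) (rank_one p k) = om *: rank_one p f.

Lemma product_value_exists p k q : p != 0 -> far 3 p k -> inner q ->
  exists om, product_value p k q om.
Proof.
move=> p0 pk iq; have [Z [bZ Zp Zq]] := inner_join (far_inner pk) iq.
pose Up := [set V | (exists U, gap 3 U V /\ U q) /\ (exists U, gap 0 U V /\ U p)].
have vUp f : vanishing Up f -> far 3 q f /\ far 0 p f.
  move=> [df [V [[[U [gV Uq]] [U' [gV' U'p]]] f0]]].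
  by split; split=> //; [exists U, V|exists U', V].
have uUp : upper_family Up.
  split.
  - have [V gV] := gap_exists 3 bZ; exists V; split; first by exists Z.
    by exists Z; split=> //; apply: gap0 gV.
  - by move=> V [[U [/gap0[_ bV _] _]] _].
  - move=> V V' [[U [gV Uq]] [U' [gV' U'p]]] VV' bV'; split.
      by exists U; split=> //; apply: gap_extend VV' bV'.
    by exists U'; split=> //; apply: gap_extend VV' bV'.
have apk := far_admissible pk.
have [|f g|f|om omE] := @functional_eigenvalue_constant p Up (fun f => B (rank_one q f)
  (rank_one p k)) p0 uUp.
- by move=> f /vUp[_]; apply: far_admissible.
- move=> /vUp[qf _] /vUp[qg _].
  by rewrite (rank_oneDr (far_admissible qf) (far_admissible qg)) (ep_add eB).
- by move=> /vUp[qf pf]; apply: product_disjoint.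
exists om => f qf pf; apply: omE; have [df [U [V [gV Uq f0]]]] := qf.
have [_ [U' [V' [gV' U'p f0']]]] := pf; split=> //.
have [[_ bV _] [_ bV' _]] := (gap0 gV, gap0 gV').
have [VV'|V'V] := below_total bV bV'.
  exists V'; split=> //; split; last by exists U'.
  by exists U; split=> //; apply: gap_extend VV' bV'.
exists V; split=> //; split; first by exists U.
by exists U'; split=> //; apply: gap_extend V'V bV.
Qed.

Lemma product_value_intro p k q om f : p != 0 -> far 3 p k -> far 3 q f -> far 0 p f ->
  (exists v, f v <> 0) -> B (rank_one q f) (rank_one p k) = om *: rank_one p f ->
  product_value p k q om.
Proof.
move=> p0 pk qf pf [v fv] E.
have [om' E'] := product_value_exists p0 pk (far_inner qf).
suff -> : om = om' by [].
have := E' f qf pf; rewrite E => /(congr1 (fun a : A => a v)).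
rewrite !opZ !rank_oneE; try exact: far_admissible pf.
move/eqP; rewrite -subr_eq0 -scalerBl !scaler_eq0 (negPf p0) orbF subr_eq0.
by move=> /orP[/eqP//|/eqP].
Qed.

Lemma product_value_scale p k q om (t : K) : product_value p k q om ->
  product_value p k (t *: q) (t * om).
Proof.
have [->|t0] := eqVneq t 0.
  move=> _ f qf pf; rewrite mul0r !scale0r.
  suff -> : rank_one 0 f = 0 :> A by rewrite (ep_0 eB).
  rewrite scale0r in qf.
  by apply: op_ext => v; rewrite rank_oneE ?scaler0//; exact: far_admissible qf.
move=> E f tqf pf.
have qf : far 3 q f.
  by rewrite -[q]scale1r -(mulVf t0) -scalerA; apply: far_scalel.
have [aq ap] := (far_admissible qf, far_admissible pf).
have -> : rank_one (t *: q) f = rank_one q (fun v => t * f v).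
  by rewrite rank_oneZl// rank_oneZr.
rewrite E; [|exact: far_scaler|exact: far_scaler].
by rewrite rank_oneZr// scalerA mulrC.
Qed.

Lemma nonzero_functional f v : f v = 1 -> exists v, f v <> 0.
Proof. by move=> fv; exists v; rewrite fv; apply/eqP; rewrite oner_eq0. Qed.

(** Equivariance with respect to w (x) g, applied to q (x) f and p (x) k *)
Lemma product_value_swap p k g w q o1 o2 : p != 0 -> far 3 p k -> far 3 p g -> far 0 w g ->
  inner q -> product_value p k w o1 ->
  (k w = 0 \/ k w = 1 /\ product_value p g q o2) -> g q * o1 = k w * o2.
Proof.
move=> p0 pk pg wg iq E1 E2.
have iw := far_inner wg; have ip := far_inner pk.
have [Z1 [b1 Zp Zq]] := inner_join ip iq; have [Z2 [b2 _ Zw]] := inner_join ip iw.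
have [Z [bZ Z1Z Z2Z]] := below_join b1 b2.
have [f [v [df iv fv fZ]]] := far_functional 3 bZ.
have [[pf qf] wf] := (fZ _ (Z1Z _ Zp), fZ _ (Z1Z _ Zq), fZ _ (Z2Z _ Zw)).
have [[apf aqf] awf] := (far_admissible pf, far_admissible qf, far_admissible wf).
have [[apk apg] awg] := (far_admissible pk, far_admissible pg, far_admissible wg).
have [om EB] := product_value_exists p0 pk iq.
have := ep_lie eB (rank_one q f) (rank_one p k) (rank_one w g).
rewrite (EB f qf (far_weaken pf)) -scalar_opM (lieZl scalar_opC) {1}/lie_bracket.
have [fw [gp gw]] := And3 (far_zero wf) (far_zero pg) (far_zero wg).
rewrite (rank_one_mul0 apf awg)// (rank_one_mul0 awg apf)// subrr mulr0.
rewrite /lie_bracket (rank_one_mul0 aqf awg)// (rank_one_mul0 awg apk)// sub0r subr0.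
rewrite (rank_one_mulE awg aqf awf) (rank_one_mulE apk awg apg) (ep_opp eB) => h.
have {h} : B (g q *: rank_one w f) (rank_one p k) =
    B (rank_one q f) (k w *: rank_one p g).
  by apply/eqP; rewrite -subr_eq0 -oppr_eq0 opprB addrC -h.
rewrite -rank_oneZl// (product_value_scale (t := g q) E1); last 2 first.
- exact: far_scalel wf.
- exact: far_weaken pf.
have rpf : rank_one p f <> 0.
  move/(congr1 (fun a : A => a v)); rewrite rank_oneE// op0 fv scale1r => /eqP.
  by rewrite (negPf p0).
case: E2 => [->|[-> E2]].
  rewrite scale0r (ep_0r eB) mul0r => /eqP; rewrite scaler_eq0 => /orP[/eqP//|/eqP].
  by move/rpf.
rewrite scale1r mul1r (E2 f qf (far_weaken pf)) => /eqP.
rewrite -subr_eq0 -scalerBl scaler_eq0 subr_eq0 => /orP[/eqP//|/eqP].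
by move/rpf.
Qed.

Lemma far_functional2 n q w : inner q -> inner w -> exists f v,
  [/\ inner v, f v = 1, far n q f & far n w f].
Proof.
move=> iq iw; have [Z [bZ Zq Zw]] := inner_join iq iw.
have [f [v [df iv fv fZ]]] := far_functional n bZ.
by exists f, v; split=> //; apply: fZ.
Qed.

Lemma inner_combination q w (t : K) : inner q -> inner w -> inner (q - t *: w).
Proof.
move=> iq iw; have [Z [bZ Zq Zw]] := inner_join iq iw; exists Z; split=> //.
have sZ := below_sub bZ.
by apply: subspaceB => //; apply: subspaceZ.
Qed.

(** By [product_value_swap] the functional vanishes on the kernel of k. *)
Lemma product_value_linear p k : p != 0 -> far 3 p k ->
  exists la, forall q, inner q -> product_value p k q (la * k q).
Proof.
move=> p0 pk; have apk := far_admissible pk; have ip := far_inner pk.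
have [nk|zk] := pselect (exists v, k v <> 0); last first.
  have k0 v : k v = 0 by apply: contrapT => kv; apply: zk; exists v.
  exists 0 => q iq f qf pf; rewrite mul0r scale0r.
  by rewrite (rank_one_zero k0 apk) (ep_0r eB).
have [w' [iw' /eqP kw']] := dual_support p0 apk (far_dual pk) nk.
pose w := (k w')^-1 *: w'; have bk := apk.1.
have kw : k w = 1 by rewrite /w bfZ// mulVf.
have iw : inner w.
  by have [V [bV Vw']] := iw'; exists V; split=> //; apply: subspaceZ => //;
    exact: below_sub.
have [o Eo] := product_value_exists p0 pk iw.
exists o => q iq; have [f [v [iv fv qf wf]]] := far_functional2 3 iq iw.
pose z := q - k q *: w; have iz : inner z by apply: inner_combination.
have kz : k z = 0 by rewrite /z bfB// bfZ// kw mulr1 subrr.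
have Ez : product_value p k z 0.
  have [oz Ez] := product_value_exists p0 pk iz.
  have [g [v' [iv' gv' pg zg]]] := far_functional2 3 ip iz.
  have := product_value_swap (o2 := 0) p0 pk pg (far_weaken zg) iv' Ez (or_introl kz).
  by rewrite gv' mul1r mulr0 => oz0; rewrite oz0 in Ez.
have [Z1 [b1 Zp Zq]] := inner_join ip iq; have [Z [bZ _ Zw]] := inner_join ip iw.
have [Z3 [b3 Z1Z ZZ]] := below_join b1 bZ.
have [h [v2 [_ _ hv hZ]]] := far_functional 3 b3.
have [[ph qh] wh] := (hZ _ (Z1Z _ Zp), hZ _ (Z1Z _ Zq), hZ _ (ZZ _ Zw)).
apply: (product_value_intro p0 pk qh (far_weaken ph) (nonzero_functional hv)).
have kqw : far 3 (k q *: w) h := far_scalel (k q) wh.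
have zh : far 3 z h by rewrite /z -scaleNr; apply: farDl => //; exact: far_scalel.
have -> : rank_one q h = rank_one z h + rank_one (k q *: w) h.
  by rewrite -(rank_oneDl (far_admissible zh) (far_admissible kqw)) subrK.
rewrite (ep_add eB) (Ez h zh (far_weaken ph)) scale0r add0r.
by rewrite (product_value_scale (t := k q) Eo kqw (far_weaken ph)) mulrC.
Qed.

(** The factors of k0 and k are both compared with that of a g that is far from p and from
    vectors where k0 and k are 1. *)
Lemma product_value_functional_free p : p != 0 -> inner p ->
  exists la, forall k, far 3 p k -> forall q, inner q -> product_value p k q (la * k q).
Proof.
move=> p0 ip; have [k0 [v0 [iv0 kv0 pk0 _]]] := far_functional2 3 ip ip.
have [la Ela] := product_value_linear p0 pk0; exists la => k pk q iq.
have [la' Ela'] := product_value_linear p0 pk; have apk := far_admissible pk.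
have [nk|zk] := pselect (exists v, k v <> 0); last first.
  have k0' v : k v = 0 by apply: contrapT => kv; apply: zk; exists v.
  by have := Ela' q iq; rewrite k0' !mulr0.
suff -> : la = la' by apply: Ela'.
have [w' [iw' /eqP kw']] := dual_support p0 apk (far_dual pk) nk.
have [w [iw kw]] : exists w, inner w /\ k w = 1.
  exists ((k w')^-1 *: w'); rewrite (bfZ _ _ apk.1) mulVf//; split=> //.
  by have [V [bV Vw']] := iw'; exists V; split=> //; apply: subspaceZ => //;
    exact: below_sub.
have [Z [bZ Zw Zv0]] := inner_join iw iv0; have [Z1 [b1 Zp _]] := inner_join ip ip.
have [Z2 [b2 ZZ2 Z12]] := below_join bZ b1.
have [g [v [_ iv gv gZ]]] := far_functional 3 b2.
have [[pg wg] vg] := (gZ _ (Z12 _ Zp), gZ _ (ZZ2 _ Zw), gZ _ (ZZ2 _ Zv0)).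
have [lg Eg] := product_value_linear p0 pg; have Egv := Eg v iv; rewrite gv mulr1 in Egv.
have key k' w1 l' : far 3 p k' -> inner w1 -> k' w1 = 1 -> far 3 w1 g ->
    (forall q, inner q -> product_value p k' q (l' * k' q)) -> l' = lg.
  move=> pk' iw1 kw1 w1g El; have Ew := El w1 iw1; rewrite kw1 mulr1 in Ew.
  have := product_value_swap p0 pk' pg (far_weaken w1g) iv Ew (or_intror (conj kw1 Egv)).
  by rewrite gv kw1 !mul1r.
by rewrite (key k0 v0 la) // (key k w la').
Qed.

Lemma product_value_constant : exists la, forall q f p k,
  far 3 q f -> far 3 p k -> far 0 p f ->
  B (rank_one q f) (rank_one p k) = (la * k q) *: rank_one p f.
Proof.
have [U0 [p0 [bU0 U0p0 p00]]] := nonzero_below.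
have ip0 : inner p0 by exists U0.
have [la Ela] := product_value_functional_free p00 ip0.
exists la => q f p k qf pk pf; have [ip iq] := (far_inner pk, far_inner qf).
have [->|pn0] := eqVneq p 0.
  have z0 g : rank_one 0 g = 0 :> A.
    apply: op_ext => v; rewrite /rank_one; case: pselect => // h.
    by have := svalP (cid (rank_one_exists h)) v => ->; rewrite scaler0.
  by rewrite !z0 (ep_0r eB) scaler0.
have [la' Ela'] := product_value_functional_free pn0 ip.
suff <- : la' = la by apply: Ela'.
have [k1 [v1 [iv1 kv1 pk1 p0k1]]] := far_functional2 3 ip ip0.
have [Z [bZ Zp Zp0]] := inner_join ip ip0; have [Z1 [b1 Zv1 _]] := inner_join iv1 iv1.
have [Z2 [b2 ZZ2 Z12]] := below_join bZ b1.
have [h [v [_ iv hv hZ]]] := far_functional 3 b2.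
have [[ph p0h] vh] := (hZ _ (ZZ2 _ Zp), hZ _ (ZZ2 _ Zp0), hZ _ (Z12 _ Zv1)).
have E0 := Ela k1 p0k1 v1 iv1 h vh (far_weaken p0h); rewrite kv1 mulr1 in E0.
have E1 := Ela' k1 pk1 v1 iv1 h vh (far_weaken ph); rewrite kv1 mulr1 in E1.
have [a0 a1] := (far_admissible p0h, far_admissible ph).
have [ak0 ak1] := (far_admissible p0k1, far_admissible pk1).
have [[s ps]|indep] := pselect (exists s : K, p = s *: p0).
  have s0 : s != 0 by apply: contraNneq pn0 => s0; rewrite ps s0 scale0r.
  have E2 := Ela _ (far_scaler s p0k1) v1 iv1 h vh (far_weaken p0h).
  have e1 : rank_one p0 (fun v => s * k1 v) = rank_one p k1.
    by rewrite rank_oneZr// ps rank_oneZl.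
  rewrite e1 E1 kv1 mulr1 ps rank_oneZl// scalerA in E2.
  move/(congr1 (fun a : A => a v)): E2; rewrite !opZ !rank_oneE// hv scale1r => /eqP.
  rewrite -subr_eq0 -scalerBl scaler_eq0 (negPf p00) orbF -mulrBl mulf_eq0 (negPf s0) orbF.
  by rewrite subr_eq0 => /eqP.
have psum : far 3 (p + p0) k1 := farDl pk1 p0k1.
have sum0 : p + p0 != 0.
  apply/negP => /eqP e; apply: indep; exists (-1); rewrite scaleN1r.
  by apply/eqP; rewrite -addr_eq0 e.
have [l2 E2] := product_value_linear sum0 psum.
have {}E2 := E2 v1 iv1 h vh (far_weaken (farDl ph p0h)); rewrite kv1 mulr1 in E2.
apply/esym; apply: (eigenvalue_eq (t'' := l2) (a := rank_one p0 h) (b := rank_one p h)).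
- rewrite -E0 -E1 [in RHS]addrC -rank_oneDl// -E2 rank_oneDl// (ep_addr eB) addrC //.
- move/(congr1 (fun a : A => a v)); rewrite rank_oneE// op0 hv scale1r => /eqP.
  by rewrite (negPf p00).
- move=> s Es; apply: indep; exists s; have := congr1 (fun a : A => a v) Es.
  by rewrite opZ !rank_oneE// hv !scale1r.
Qed.

(** For p (x) f = [p (x) k, v (x) f], equivariance expresses B x (p (x) f) through
    B x (p (x) k) and through B x (v (x) f).  After subtraction of the Jordan product the
    second expression takes values in the line of p where k vanishes, the first one takes
    the kernel of f into the line of v.  The nine steps are three between p and the kernel
    of k, three to find v, and three between v and the kernel of f. *)
Lemma product_rank_one la :
  (forall q f p k, far 3 q f -> far 3 p k -> far 0 p f ->
     B (rank_one q f) (rank_one p k) = (la * k q) *: rank_one p f) ->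
  forall x p f, far 9 p f -> exists t,
    B x (rank_one p f) - la *: (x * rank_one p f + rank_one p f * x) = t *: rank_one p f.
Proof.
move=> laE x p f pf9; have [[bf fu] [U0 [U4 [g9 U0p f0]]]] := pf9.
have [U1 [g01 g14]] := gap_split (m := 3) (n := 6) g9.
have [U3 [g13 g34]] := gap_split (m := 3) (n := 3) g14.
have [[b0 b1 U01] [_ b3 U13] [_ b4 U34]] := And3 (gap0 g01) (gap0 g13) (gap0 g34).
have pf := far_weaken pf9; have apf := far_admissible pf.
have key w : exists v (a b : K), [/\ ~ U1 v,
    (B x (rank_one p f) - la *: (x * rank_one p f + rank_one p f * x)) w = a *: p &
    f w = 0 -> (B x (rank_one p f) - la *: (x * rank_one p f + rank_one p f * x)) w
      = b *: v].
  have [v [U3v nv]] := gap_escape 0 w g13.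
  have [k [[bk ku] k0 _ kw kv]] := separate_plane b1 (rng 0) (rng w) (rng v) nv.
  have nU1v : ~ U1 v by move=> U1v; apply: nv; do 2! apply: sub_add_line.
  have pk : far 3 p k by split=> //; exists U0, U1.
  have vf : far 3 v f by split=> //; exists U3, U4.
  have [apk avf] := (far_admissible pk, far_admissible vf).
  have E : [!rank_one p k, rank_one v f] = rank_one p f.
    rewrite /lie_bracket (rank_one_mulE apk avf apf) (rank_one_mul0 avf apk) ?(far_zero
      pf)//.
    by rewrite kv scale1r subr0.
  have lie_r q g : admissible q g ->
      [!x, rank_one q g] = rank_one (x q) g - rank_one q (fun z => g (x z)).
    by move=> aq; rewrite /lie_bracket mul_rank_one// rank_one_mul.
  have [axp axf] := (admissible_op x apf, admissible_comp x apf).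
  have E1 : B x (rank_one p f) = [!B x (rank_one p k), rank_one v f]
      - ((la * k (x v)) *: rank_one p f - la *: rank_one p (fun z => f (x z))).
    have := ep_lie eB x (rank_one p k) (rank_one v f); rewrite E lie_r// => ->.
    rewrite (ep_add eB) (ep_opp eB) (laE _ _ _ _ (far_op x vf) pk pf).
    rewrite (laE _ _ _ _ (far_comp (C1 x) vf) pk (far_comp (C1 x) pf)) kv mulr1.
    by rewrite addrAC subrr add0r.
  have E2 : B x (rank_one p f) = la *: rank_one (x p) f - (la * k (x v)) *: rank_one p f
      - [!B x (rank_one v f), rank_one p k].
    have := ep_lie eB x (rank_one v f) (rank_one p k).
    rewrite lie_r// (lieC (rank_one v f) (rank_one p k)) E (ep_oppr eB) (ep_add eB)
      (ep_opp eB).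
    rewrite !(ep_sym eB _ (rank_one v f)).
    rewrite (laE _ _ _ _ vf (far_op x pk) (far_op x pf)) kv mulr1.
    rewrite (laE _ _ _ _ vf (far_comp (C1 x) pk) pf) => ->.
    by rewrite opprB addrCA subrr addr0.
  exists v, (k (B x (rank_one v f) w) - la * k (x v) * f w - la * f (x w)),
    (- f (B x (rank_one p k) w)); split=> //.
    rewrite E2 /lie_bracket !opB !opZ opD !opM !rank_oneE// kw scale0r op_v0 sub0r.
    rewrite opprK scalerDr op_scalev !scalerBl !scalerA opprD addrA.
    by rewrite -(addrA (la * f w *: x p)) (addrC (la * f w *: x p)) addrK (addrC (- _)).
  move=> fw; rewrite E1 /lie_bracket !opB !opZ opD !opM !rank_oneE// fw !scale0r.
  by rewrite !op_v0 scaler0 !sub0r opprK add0r addrK scaleNr.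
apply: multiple_of_rank_one => // w; first by have [_ [a [_ [_ Ea _]]]] := key w; exists a.
move=> fw; have [v [a [b [nv Ea /(_ fw)]]]] := key w.
rewrite Ea => Eb; have [b_0|b_0] := eqVneq b 0; first by rewrite Eb b_0 scale0r.
case: nv; have -> : v = (b^-1 * a) *: p by rewrite -scalerA Eb scalerA mulVf// scale1r.
by apply: subspaceZ; [exact: below_sub|apply: U01].
Qed.

Lemma limit_standard : standard_product scalar_op B.
Proof.
have [la laE] := product_value_constant; have prod := product_rank_one laE.
have [B' [eB' B'E]] : exists B', equivariant_product B' /\
    forall x y, B' x y = B x y - scalar_op la * (x * y + y * x).
  by eexists; split; first exact: (equivariant_sub_jordan scalar_opC eB la).
have eig x : exists m : K, forall p f, far 9 p f ->
    B' x (rank_one p f) = m *: rank_one p f.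
  apply: far_eigenvalue_constant => [a b _ _|p f pf]; first exact: (ep_addr eB').
  by have [t Et] := prod x p f pf; exists t; rewrite -Et B'E scalar_opM.
have [mu muE] := choice eig.
exists la, mu => x y.
suff [t tE] : exists t, B' x y - mu x *: y - mu y *: x = scalar_op t * u.
  exists t; apply: (eq_from tE); rewrite u1 mulr1 B'E -!scalar_opM /=; ncring.
apply: (far_commutant (n := 9) (C1 _)) => p f pf.
have af := far_admissible pf.
have xr z : [!z, rank_one p f] = rank_one (z p) f - rank_one p (fun w => f (z w)).
  by rewrite /lie_bracket mul_rank_one// rank_one_mul.
have Br z z' : B' z [!z', rank_one p f] = mu z *: [!z', rank_one p f].
  rewrite xr (ep_addr eB') (ep_oppr eB') (muE _ _ _ (far_op z' pf)).
  by rewrite (muE _ _ _ (far_comp (C1 z') pf)) scalerBr.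
apply/eqP; rewrite -subr_eq0 -[X in X == _]/([!_, _]); apply/eqP.
rewrite !lieBl (ep_lie eB') (ep_sym eB' _ y) !Br -!scalar_opM !(lieZl scalar_opC); ncring.
Qed.

End Whole.

(** With x = p (x) k, z = q (x) f and y = w (x) g one gets [y, [x, z]] = w (x) f, where w
    is in a smaller member of the nest than p and q. *)
Lemma limit_large : u = 1 -> exists x y z : A, forall a b c : K,
  [!y, [!x, z]] <> scalar_op a * x + scalar_op b * z + scalar_op c.
Proof.
move=> u1; have rng v : u v = v by rewrite u1.
have [up _ b0] := lu; have [W [bW _ /not_sub_ex[w [Ww w0]]]] := up _ b0.
have [U [bU WU /not_sub_ex[p [Up nWp]]]] := up _ bW.
have [V gV] := gap_exists 3 bU; have [q [Vq nq]] := gap_escape 0 0 gV.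
have [_ bV UV] := gap0 gV.
have [k [[bk ku] k0 _ _ kq]] := separate_plane bU (rng 0) (rng 0) (rng q) nq.
have nWp' : ~ add_line (add_line W 0) 0 p.
  by move=> [t]; rewrite scaler0 subr0 => -[s]; rewrite scaler0 subr0.
have [g [[bg gu] g0 _ _ gp]] := separate_plane bW (rng 0) (rng 0) (rng p) nWp'.
have [f [v [[bf fu] iv fv fV]]] := far_functional 0 bV.
have [[pf qf] wf] := (fV _ (UV _ Up), fV _ Vq, fV _ (UV _ (WU _ Ww))).
have [[apf aqf] awf] := (far_admissible pf, far_admissible qf, far_admissible wf).
have apk := admissible_between bU Up bk k0.
have awg := admissible_between bW Ww bg g0.
exists (rank_one p k), (rank_one w g), (rank_one q f) => a b c.
have -> : [!rank_one p k, rank_one q f] = rank_one p f.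
  rewrite /lie_bracket (rank_one_mulE apk aqf apf) (rank_one_mul0 aqf apk) ?(far_zero pf)//.
  by rewrite kq scale1r subr0.
have -> : [!rank_one w g, rank_one p f] = rank_one w f.
  rewrite /lie_bracket (rank_one_mulE awg apf awf) (rank_one_mul0 apf awg) ?(far_zero wf)//.
  by rewrite gp scale1r subr0.
move=> E; have Ev z : f z *: w = a *: (k z *: p) + b *: (f z *: q) + c *: z.
  have := congr1 (fun x : A => x z) E.
  by rewrite !opD !opM !scalar_opE !rank_oneE.
have p0 : p != 0 by apply/eqP => p0; apply: nWp; rewrite p0; exact: (below_sub bW).1.
have c0 : c = 0.
  have := Ev p; rewrite (far_zero pf) (k0 _ Up) !scale0r !scaler0 !add0r => /esym/eqP.
  by rewrite scaler_eq0 (negPf p0) orbF => /eqP.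
have a0 : a = 0.
  have := Ev q; rewrite (far_zero qf) kq c0 !scale0r scale1r scaler0 !addr0 => /esym/eqP.
  by rewrite scaler_eq0 (negPf p0) orbF => /eqP.
have := Ev v; rewrite fv a0 c0 !scale0r !scale1r addr0 add0r => wq; apply: w0.
have := congr1 k wq; rewrite bfZ// kq mulr1 k0; last exact: WU.
by move=> b_0; rewrite wq -b_0 scale0r.
Qed.

End Limit.

(** * Nest algebras *)

Lemma nest_center u : comparable u -> trivial_center scalar_op u.
Proof.
move=> cu; have [-> c [<- _] _|[p [g at_u]]|lu] := nest_dichotomy cu.
- by exists 0; rewrite mul0r mulr0.
- exact: atom_center at_u.
- exact: limit_center lu.
Qed.

(** In the atom case the centroid is reduced to the center of the corner below the atom,
    which [nest_center] computes. *)
Lemma nest_centroid u : comparable u -> trivial_centroid scalar_op u.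
Proof.
move=> cu; have [->|[p [g at_u]]|lu] := nest_dichotomy cu.
- move=> T Tu _ _; exists 0, (fun _ => 0) => x ux.
  by have [<- _] := Tu x ux; rewrite mul0r mulr0 rmorph0 mul0r addr0.
- apply: (minimal_corner_centroid scalar_opC (atom_minimal_corner cu at_u)).
  exact/nest_center/atom_comparable.
- exact: limit_centroid lu.
Qed.

Lemma nest_standard B : equivariant_product B -> standard_product scalar_op B.
Proof.
have c1 := comparable1; have [one0|[p [g at_1]]|l1] := nest_dichotomy c1 => eB.
- have z (x : A) : x = 0 by rewrite -[x]mul1r one0 mul0r.
  by exists 0, (fun _ => 0) => x y; exists 0; rewrite [LHS]z [RHS]z.
- have mc := atom_minimal_corner c1 at_1; have cv := atom_comparable c1 at_1.
  by apply: (minimal_idempotent_standard scalar_opC mc) => //;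
    [exact: nest_center|exact: nest_centroid].
- exact: limit_standard c1 l1 erefl _ eB.
Qed.

Lemma nest_large_or_standard :
  (exists x y z : A, forall a b c : K,
     [!y, [!x, z]] <> scalar_op a * x + scalar_op b * z + scalar_op c) \/
  exists sg : A -> K, forall x y, exists t,
    x * y + y * x = scalar_op (sg x) * y + scalar_op (sg y) * x + scalar_op t.
Proof.
have c1 := comparable1; have [one0|[p [g at_1]]|l1] := nest_dichotomy c1.
- have z (x : A) : x = 0 by rewrite -[x]mul1r one0 mul0r.
  by right; exists (fun _ => 0) => x y; exists 0; rewrite [LHS]z [RHS]z.
- exact: (minimal_idempotent_large_or_standard scalar_opC (atom_minimal_corner c1 at_1)).
- by left; apply: limit_large c1 l1 erefl.
Qed.

Lemma nest_central c : (forall x, c * x = x * c) -> exists t, c = scalar_op t.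
Proof.
move=> cc; have [||t ->] := nest_center comparable1 (c := c).
- by split; rewrite ?mul1r ?mulr1.
- by move=> x _; apply: cc.
- by exists t; rewrite mulr1.
Qed.

End NestAlgebra.

Theorem theorem1p1 (R : realType) (k : scalar_kind)
    (X Y : completeNormedModType (scalar_field R k)) (N : nest X) (M : nest Y)
    (Phi : nest_alg N -> nest_alg M) :
  lie_ring_isomorphism Phi <->
  bijective Phi /\
  exists (Psi : nest_alg N -> nest_alg M) (h : nest_alg N -> scalar_field R k),
    [/\ ring_isomorphism Psi \/
          (exists Theta : nest_alg N -> nest_alg M,
             ring_antiisomorphism Theta /\ forall A, Psi A = - Theta A),
        {morph h : A B / A + B},
        forall A B : nest_alg N, h (lie_bracket A B) = 0
      & forall A, Phi A = Psi A + h A *: (1 : nest_alg M)].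
Proof.
have [sepX sepY] := (@separating_scalar_field R k X, @separating_scalar_field R k Y).
split=> [[PhiD PhiL Phi_bij]|[Phi_bij [Psi [h [PsiP hD hL PhiE]]]]]; last first.
  exact: (standard_form_lie (s2 := scalar_op M) (@scalar_opC _ _ M) PsiP hD hL PhiE
    Phi_bij).
split=> //.
have [noncomm|comm] := pselect (exists p q : nest_alg M, p * q <> q * p).
  have [Psi [h [PsiP hD hL PhiE]]] := (lie_isomorphism_standard (s1 := scalar_op N) (s2
    := scalar_op M)
    (@scalar_opC _ _ N) (@scalar_opC _ _ M) (nest_central sepX) (nest_central sepY)
    (nest_centroid sepX (comparable1 N)) (@nest_standard _ _ M sepY)
      (nest_large_or_standard M sepY)
    noncomm PhiD PhiL Phi_bij).
  by exists Psi, h; split.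
have comm2 (x y : nest_alg M) : x * y = y * x.
  by apply: contrapT => xy; apply: comm; exists x, y.
have comm1 (x y : nest_alg N) : x * y = y * x.
  have Phi0 : Phi 0 = 0 by apply: (addrI (Phi 0)); rewrite -PhiD !addr0.
  apply/eqP; rewrite -subr_eq0; apply/eqP; apply: (bij_inj Phi_bij).
  by rewrite Phi0 [LHS]PhiL /lie_bracket comm2 subrr.
have [||Psi [h [isoPsi hD hL PhiE]]] :=
    scalar_lie_isomorphism (s1 := scalar_op N) (s2 := scalar_op M) _ _ PhiD Phi_bij.
- by move=> x; apply: (nest_central sepX).
- by move=> x; apply: (nest_central sepY).
- by exists Psi, h; split=> //; left.
Qed.
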